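(* The variety of $UT_2$-algebras generated by $UT_2^D$ has almost polynomial growth.
   Context: $F$ is a field of characteristic zero; all algebras are associative $F$-algebras. $UT_2$ is the algebra of $2\times 2$ upper triangular matrices over $F$, with matrix units $e_{ij}$ and basis $\{1=e_{11}+e_{22},\,e_{22},\,e_{12}\}$. Put $W=UT_2$. A $W$-algebra is an algebra $A$ that is a (unital) $W$-bimodule such that $w(a_1a_2)=(wa_1)a_2$, $(a_1a_2)w=a_1(a_2w)$, $(a_1w)a_2=a_1(wa_2)$ for all $w\in W$, $a_1,a_2\in A$. The free $W$-algebra $W\langle X\rangle$ on $X=\{x_1,x_2,\dots\}$ has as $F$-basis the words $w_{0}x_{j_1}w_{1}x_{j_2}\cdots w_{n-1}x_{j_n}w_{n}$, $n\ge 1$, with $w_0,\dots,w_n$ in the basis $\{1,e_{22},e_{12}\}$ of $W$ ($x_i=1x_i=x_i1$), with juxtaposition product and expansion of products of adjacent coefficients in the basis of $W$. For a $W$-algebra $A$, $\mathrm{GId}(A)$ is the set of $f(x_1,\dots,x_n)\in W\langle X\rangle$ with $f(a_1,\dots,a_n)=0$ for all $a_i\in A$. $GP_n$ is the $F$-span of the elements $w_{0}x_{\sigma(1)}w_{1}\cdots w_{n-1}x_{\sigma(n)}w_{n}$, with $\sigma\in S_n$ and $w_i\in W$, and $gc_n(A)=\dim_F GP_n/(GP_n\cap\mathrm{GId}(A))$. $UT_2^D$ denotes the algebra $UT_2$ with the $UT_2$-algebra structure in which $1$ and $e_{22}$ act by the usual left and right multiplication, while $e_{12}\cdot a=a\cdot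 e_{12}=0$ for all $a\in UT_2$ (extended linearly). $\mathrm{gvar}(A)$ is the variety of $W$-algebras generated by $A$, i.e. the class of all $W$-algebras $B$ with $\mathrm{GId}(A)\subseteq\mathrm{GId}(B)$. For $\mathcal V=\mathrm{gvar}(A)$ put $\mathrm{GId}(\mathcal V)=\mathrm{GId}(A)$ and $gc_n(\mathcal V)=gc_n(A)$. $\mathcal V$ has polynomial growth if $gc_n(\mathcal V)$, $n\ge1$, is polynomially bounded; it has almost polynomial growth if $gc_n(\mathcal V)$ is not polynomially bounded but every proper generalized subvariety of $\mathcal V$ has polynomial growth. *)

(* Defs.v *)
From HB Require Import structures.
From mathcomp Require Import all_boot all_order all_algebra.
From mathcomp Require Import boolp classical_sets.
From mathcomp Require Import finmap monalg.

Set Implicit Arguments.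
Unset Strict Implicit.
Unset Printing Implicit Defensive.

Import GRing.Theory.
Local Open Scope classical_set_scope.
Local Open Scope ring_scope.

Section UpperTriangular.
Variable F : fieldType.

Definition upper_trig : {pred 'M[F]_2} := fun A => is_trig_mx A^T.

Lemma upper_trigE A : (A \in upper_trig) = (A 1 0 == 0).
Proof.
apply/is_trig_mxP/eqP => [/(_ 0 1 isT)|A10 i j]; first by rewrite mxE.
rewrite mxE; case: i => [[|[|//]] hi]; case: j => [[|[|//]] hj] //= _.
by rewrite -[RHS]A10; congr (A _ _); apply: val_inj.
Qed.

Lemma upper_trig_subalg_closed : subalg_closed upper_trig.
Proof.
split=> [|c A B|A B]; rewrite !upper_trigE; first by rewrite mxE.
- by move=> /eqP A0 /eqP B0; rewrite !mxE A0 B0 mulr0 addr0.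
- move=> /eqP A0 /eqP B0; rewrite mxE !big_ord_recl big_ord0.
  have -> : lift ord0 ord0 = 1 :> 'I_2 by apply: val_inj.
  by rewrite A0 B0 mul0r mulr0 !addr0.
Qed.

HB.instance Definition _ :=
  GRing.isSubalgClosed.Build F 'M[F]_2 upper_trig upper_trig_subalg_closed.

Record UT2 := MkUT2 { utval :> 'M[F]_2; _ : utval \in upper_trig }.

HB.instance Definition _ := [isSub for utval].
HB.instance Definition _ := [Choice of UT2 by <:].
HB.instance Definition _ := [SubChoice_isSubAlgebra of UT2 by <:].

Lemma upper_trig_delta (i : 'I_2) : delta_mx i 1 \in upper_trig.
Proof. by rewrite upper_trigE mxE andbF. Qed.

Definition e22 : UT2 := MkUT2 (upper_trig_delta 1).
Definition e12 : UT2 := MkUT2 (upper_trig_delta 0).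

Definition wbasis (b : 'I_3) : UT2 := tnth [tuple 1; e22; e12] b.

Definition wcoord (w : UT2) (b : 'I_3) : F :=
  tnth [tuple w 0 0; w 1 1 - w 0 0; w 0 1] b.

Lemma wcoord_linear b : linear ((wcoord^~ b) : UT2 -> F^o).
Proof.
move=> c v w; rewrite /wcoord.
have E : forall i j, (c *: v + w) i j = c * v i j + w i j.
  by move=> i j; rewrite /= !mxE.
case: b => [[|[|[|//]]] h]; rewrite !(tnth_nth 0) /= !E //.
by rewrite scalerDr scalerN opprD addrACA.
Qed.

Lemma wcoordE w : w = \sum_b wcoord w b *: wbasis b.
Proof.
apply: val_inj; apply/matrixP => i j.
have := valP w; rewrite upper_trigE => /eqP w10.
rewrite !big_ord_recl big_ord0 /wcoord /wbasis !(tnth_nth 0) /= !mxE.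
have I2 (k : 'I_2) : k = 0 \/ k = 1.
  by case: k => [[|[|//]] hk]; [left|right]; apply: val_inj.
by case: (I2 i) => ->; case: (I2 j) => ->;
  rewrite /= ?(mulr0, mulr1, addr0, add0r, w10) // addrC subrK.
Qed.

Lemma wcoord_basis b c : wcoord (wbasis b) c = (b == c)%:R.
Proof.
by case: b => [[|[|[|//]]] h]; case: c => [[|[|[|//]]] h'];
  rewrite /wcoord /wbasis !(tnth_nth 0) /= ?mxE //= ?(subrr, subr0).
Qed.
End UpperTriangular.

(* W-algebras for W = UT2 F.  The algebra structure of the carrier is not      *)
(* required to be unital, hence the explicit bilinear product.                 *)
Record walg (F : fieldType) := WAlg {
  wcarrier :> lmodType F;
  wmul : wcarrier -> wcarrier -> wcarrier;
  lact : UT2 F -> wcarrier -> wcarrier;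
  ract : wcarrier -> UT2 F -> wcarrier;
  wmulA : associative wmul;
  wmul_linearl : forall b, linear (wmul^~ b);
  wmul_linearr : forall a, linear (wmul a);
  lact_linearl : forall a, linear (lact^~ a);
  lact_linearr : forall w, linear (lact w);
  ract_linearl : forall w, linear (ract^~ w);
  ract_linearr : forall a, linear (ract a);
  lact1 : forall a, lact 1 a = a;
  ract1 : forall a, ract a 1 = a;
  lactM : forall v w a, lact (v * w) a = lact v (lact w a);
  ractM : forall a v w, ract a (v * w) = ract (ract a v) w;
  lractA : forall v a w, ract (lact v a) w = lact v (ract a w);
  lact_wmul : forall w a b, lact w (wmul a b) = wmul (lact w a) b;
  ract_wmul : forall a b w, ract (wmul a b) w = wmul a (ract b w);
  wmul_ract : forall a w b, wmul (ract a w) b = wmul a (lact w b)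
}.

(* (c, j, s, d) with s = [:: (c_1, j_1); ...; (c_k, j_k)] stands for the word  *)
(* c x_j c_1 x_(j_1) ... c_k x_(j_k) d, of degree k + 1; variables are indexed *)
(* from 0, so that x_j is the variable number j + 1.                           *)
Definition word (C : Type) := (C * nat * seq (C * nat) * C)%type.
HB.instance Definition _ (C : choiceType) :=
  Choice.copy (word C) (C * nat * seq (C * nat) * C)%type.

Definition word_fst C (u : word C) : C := u.1.1.1.
Definition word_lst C (u : word C) : C := u.2.
Definition letters C (u : word C) : seq nat := u.1.1.2 :: unzip2 u.1.2.

Definition set_fst C (c : C) (u : word C) : word C :=
  (c, u.1.1.2, u.1.2, u.2).
Definition set_lst C (u : word C) (c : C) : word C := (u.1, c).
Definition word_cat C (u : word C) (c : C) (v : word C) : word C :=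
  (u.1.1, u.1.2 ++ (c, v.1.1.2) :: v.1.2, v.2).
Definition map_word C D (h : C -> D) (u : word C) : word D :=
  (h u.1.1.1, u.1.1.2, [seq (h p.1, p.2) | p <- u.1.2], h u.2).

Section WordValue.
Variables (F : fieldType) (A : walg F) (a : nat -> A).

Definition word_val (u : word (UT2 F)) : A :=
  ract (foldl (fun m p => wmul m (lact p.1 (a p.2)))
              (lact (word_fst u) (a u.1.1.2)) u.1.2)
       (word_lst u).

End WordValue.

Section FreeWAlgebra.
Variable F : fieldType.

Definition freemod : lmodType F := {malg F[word 'I_3]}.
Definition bword (u : word 'I_3) : freemod := << (1 : F) *g u >>.

Section Extension.
Variables (M : lmodType F) (phi : word 'I_3 -> M).

Definition lin_ext (f : freemod) : M := \sum_(u <- msupp f) f@_u *: phi u.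

Lemma lin_extEw (f : freemod) (D : {fset word 'I_3}) :
  fsubset (msupp f) D -> lin_ext f = \sum_(u <- D) f@_u *: phi u.
Proof.
move=> sD; rewrite /lin_ext; apply: big_fset_incl => // u _ uf.
by rewrite (mcoeff_outdom uf) scale0r.
Qed.

Lemma lin_ext_linear : linear lin_ext.
Proof.
move=> c f g; set D := fsetU (msupp f) (msupp g).
rewrite (@lin_extEw f D) ?fsubsetUl // (@lin_extEw g D) ?fsubsetUr //.
rewrite (@lin_extEw _ D).
  rewrite scaler_sumr -big_split /=; apply: eq_bigr => u _.
  by rewrite mcoeffD mcoeffZ scalerDl scalerA.
by apply: fsubset_trans (msuppD_le _ _) _; apply: fsetSU; apply: msuppZ_le.
Qed.

Lemma lin_extU u : lin_ext (bword u) = phi u.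
Proof.
rewrite (@lin_extEw _ [fset u]%fset) ?msuppU_le //.
by rewrite big_seq_fset1 mcoeffUU scale1r.
Qed.

End Extension.
Lemma linear_big (U M : lmodType F) (h : U -> M) (I : finType) c (x : I -> U) :
  linear h -> h (\sum_i c i *: x i) = \sum_i c i *: h (x i).
Proof.
move=> hl; have h0 : h 0 = 0.
  by have := hl (-1) 0 0; rewrite scaler0 addr0 scaleN1r addNr.
have hD x1 x2 : h (x1 + x2) = h x1 + h x2 by rewrite -[x1]scale1r hl !scale1r.
rewrite (big_morph h hD h0); apply: eq_bigr => i _.
by rewrite -[_ *: _]addr0 hl h0 addr0.
Qed.

Lemma scale_bword (c : F) u : c *: (bword u) = << c *g u >>.
Proof.
rewrite /bword; apply/malgP => v.
by rewrite mcoeffU (@mcoeffZ (word 'I_3) F c) mcoeffU mulr_natr.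
Qed.

Lemma linear_malg_eq (M : lmodType F) (h1 h2 : freemod -> M) :
  linear h1 -> linear h2 -> (forall u, h1 (bword u) = h2 (bword u)) -> h1 =1 h2.
Proof.
move=> l1 l2 E f.
have -> : f = \sum_(u : msupp f) f@_(val u) *: (bword (val u)).
  rewrite {1}(monalgE f) big_seq_fsetE; apply: eq_bigr => u _ /=.
  by rewrite scale_bword.
by rewrite !linear_big //; apply: eq_bigr => u _; rewrite E.
Qed.

Lemma linear_comp (U V M : lmodType F) (h : V -> M) (g : U -> V) :
  linear h -> linear g -> linear (fun x => h (g x)).
Proof. by move=> hl gl c x y; rewrite gl hl. Qed.

Lemma lin_ext_linear_fun (U M : lmodType F) (phi : U -> word 'I_3 -> M) f :
  (forall u, linear (phi^~ u)) -> linear (fun x => lin_ext (phi x) f).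
Proof.
move=> pl c x y; rewrite /lin_ext scaler_sumr -big_split /=.
by apply: eq_bigr => u _; rewrite pl scalerDr !scalerA mulrC.
Qed.

(* \sum_b w_b k(b), where w = \sum_b w_b b in the basis {1, e22, e12}: with k b *)
(* a word having coefficient b at some place, the word with w at that place.   *)
Definition wexp (w : UT2 F) (k : 'I_3 -> word 'I_3) : freemod :=
  \sum_b wcoord w b *: (bword (k b)).

Lemma wexp_linear k : linear (wexp^~ k).
Proof.
move=> c v w; rewrite /wexp scaler_sumr -big_split; apply: eq_bigr => b _ /=.
by rewrite (wcoord_linear b) scalerDl scalerA.
Qed.

Lemma wexp_basis b k : wexp (wbasis F b) k = (bword (k b)).
Proof.
rewrite /wexp (bigD1 b) //= wcoord_basis eqxx scale1r big1 ?addr0 // => c cb.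
by rewrite wcoord_basis eq_sym (negPf cb) scale0r.
Qed.

Lemma wexp_ext (M : lmodType F) (h : freemod -> M) (G : UT2 F -> M) w k :
  linear h -> linear G -> (forall b, h (bword (k b)) = G (wbasis F b)) ->
  h (wexp w k) = G w.
Proof.
move=> hl Gl E; rewrite {2}(wcoordE w) /wexp !linear_big //.
by apply: eq_bigr => b _; rewrite E.
Qed.

Definition free_mul (f g : freemod) : freemod :=
  lin_ext (fun u => lin_ext (fun v =>
    wexp (wbasis F (word_lst u) * wbasis F (word_fst v))
         (fun b => word_cat u b v)) g) f.
Definition free_lact (w : UT2 F) (f : freemod) : freemod :=
  lin_ext (fun u => wexp (w * wbasis F (word_fst u)) (fun b => set_fst b u)) f.
Definition free_ract (f : freemod) (w : UT2 F) : freemod :=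
  lin_ext (fun u => wexp (wbasis F (word_lst u) * w) (set_lst u)) f.

Lemma wmull_linear (w : UT2 F) : linear (fun v : UT2 F => w * v).
Proof. by move=> c x y; rewrite mulrDr scalerAr. Qed.
Lemma wmulr_linear (w : UT2 F) : linear (fun v : UT2 F => v * w).
Proof. by move=> c x y; rewrite mulrDl scalerAl. Qed.
#[local] Hint Resolve wmull_linear wmulr_linear wexp_linear lin_ext_linear : core.

Lemma free_mulUU u v : free_mul (bword u) (bword v) =
  wexp (wbasis F (word_lst u) * wbasis F (word_fst v)) (fun b => word_cat u b v).
Proof. by rewrite /free_mul !lin_extU. Qed.
Lemma free_lactU w u :
  free_lact w (bword u) = wexp (w * wbasis F (word_fst u)) (fun b => set_fst b u).
Proof. exact: lin_extU. Qed.
Lemma free_ractU w u :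
  free_ract (bword u) w = wexp (wbasis F (word_lst u) * w) (set_lst u).
Proof. exact: lin_extU. Qed.

Lemma free_mul_linearl g : linear (free_mul^~ g).
Proof. exact: lin_ext_linear. Qed.
Lemma free_mul_linearr f : linear (free_mul f).
Proof. by apply: lin_ext_linear_fun => u; apply: lin_ext_linear. Qed.
Lemma free_lact_linearr w : linear (free_lact w).
Proof. exact: lin_ext_linear. Qed.
Lemma free_ract_linearl w : linear (free_ract^~ w).
Proof. exact: lin_ext_linear. Qed.
Lemma free_lact_linearl f : linear (free_lact^~ f).
Proof.
by apply: lin_ext_linear_fun => u; apply: (linear_comp (@wexp_linear _)).
Qed.
Lemma free_ract_linearr f : linear (free_ract f).
Proof.
by apply: lin_ext_linear_fun => u; apply: (linear_comp (@wexp_linear _)).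
Qed.

#[local] Hint Resolve free_mul_linearl free_mul_linearr free_lact_linearr
  free_ract_linearl free_lact_linearl free_ract_linearr : core.

Lemma wexp_mull_linear w k : linear (fun v : UT2 F => wexp (w * v) k).
Proof. exact: (linear_comp (@wexp_linear k)). Qed.
Lemma wexp_mulr_linear w k : linear (fun v : UT2 F => wexp (v * w) k).
Proof. exact: (linear_comp (@wexp_linear k)). Qed.
#[local] Hint Resolve wexp_mull_linear wexp_mulr_linear : core.

Lemma free_lact_wexp w (v : UT2 F) k k' :
  (forall b, word_fst (k b) = b) ->
  (forall b c, set_fst c (k b) = k' c) ->
  free_lact w (wexp v k) = wexp (w * v) k'.
Proof.
move=> kf kk; rewrite (wexp_ext (G := fun v => wexp (w * v) k')) // => b.
by rewrite free_lactU kf; congr wexp; apply: funext => c; rewrite kk.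
Qed.

Lemma free_ract_wexp w (v : UT2 F) k k' :
  (forall b, word_lst (k b) = b) ->
  (forall b c, set_lst (k b) c = k' c) ->
  free_ract (wexp v k) w = wexp (v * w) k'.
Proof.
move=> kf kk.
rewrite (wexp_ext (h := free_ract^~ w) (G := fun v => wexp (v * w) k')) // => b.
by rewrite free_ractU kf; congr wexp; apply: funext => c; rewrite kk.
Qed.

Lemma wexp_exchange (h1 h2 : freemod -> freemod)
    (p q : UT2 F) k1 k2 k x y :
  x = wexp p k1 -> y = wexp q k2 -> linear h1 -> linear h2 ->
  (forall b, h1 (bword (k1 b)) = wexp q (k b)) ->
  (forall c, h2 (bword (k2 c)) = wexp p (fun b => k b c)) ->
  h1 x = h2 y.
Proof.
move=> -> -> l1 l2 E1 E2; rewrite [X in h1 X]/wexp [X in h2 X]/wexp.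
rewrite (linear_big _ _ l1) (linear_big _ _ l2).
transitivity (\sum_b \sum_c (wcoord p b * wcoord q c) *: bword (k b c)).
  apply: eq_bigr => b _; rewrite E1 /wexp scaler_sumr.
  by apply: eq_bigr => c _; apply: scalerA.
rewrite exchange_big; apply: eq_bigr => c _; rewrite E2 /wexp scaler_sumr.
by apply: eq_bigr => b _; rewrite [RHS]scalerA [in RHS]mulrC.
Qed.

Lemma free_mulA : associative free_mul.
Proof.
move=> f g h.
apply: (linear_malg_eq (h1 := fun f => free_mul f (free_mul g h))
          (h2 := fun f => free_mul (free_mul f g) h)) f => [||u].
- exact: free_mul_linearl.
- exact: (linear_comp (free_mul_linearl h) (free_mul_linearl g)).
apply: (linear_malg_eq (h1 := fun g => free_mul (bword u) (free_mul g h))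
          (h2 := fun g => free_mul (free_mul (bword u) g) h)) g => [||v].
- exact: (linear_comp (free_mul_linearr _) (free_mul_linearl h)).
- exact: (linear_comp (free_mul_linearl h) (free_mul_linearr _)).
apply: (linear_malg_eq
          (h1 := fun h => free_mul (bword u) (free_mul (bword v) h))) h
  => [||w].
- exact: (linear_comp (free_mul_linearr _) (free_mul_linearr _)).
- exact: free_mul_linearr.
apply: (wexp_exchange (h2 := free_mul^~ (bword w))
          (k := fun c b => word_cat (word_cat u b v) c w)
          (free_mulUU v w) (free_mulUU u v)) => [||b|b].
- exact: free_mul_linearr.
- exact: free_mul_linearl.
- rewrite free_mulUU; congr wexp; apply: funext => c.
  by rewrite /word_cat /= -catA.
- exact: free_mulUU.
Qed.

Lemma free_lact1 f : free_lact 1 f = f.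
Proof.
apply: (linear_malg_eq (h2 := id)) f => [||u].
- exact: free_lact_linearr.
- by [].
rewrite free_lactU mul1r wexp_basis.
by case: u => [[[? ?] ?] ?].
Qed.

Lemma free_ract1 f : free_ract f 1 = f.
Proof.
apply: (linear_malg_eq (h1 := free_ract^~ 1) (h2 := id)) f => [||u].
- exact: free_ract_linearl.
- by [].
rewrite free_ractU mulr1 wexp_basis.
by case: u => [[[? ?] ?] ?].
Qed.

Lemma free_lactM v w f : free_lact (v * w) f = free_lact v (free_lact w f).
Proof.
apply: (linear_malg_eq (h2 := fun f => free_lact v (free_lact w f))) f
  => [||u].
- exact: free_lact_linearr.
- exact: (linear_comp (free_lact_linearr v) (free_lact_linearr w)).
transitivity (wexp (v * w * wbasis F (word_fst u)) (fun b => set_fst b u)).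
  exact: free_lactU.
rewrite -mulrA; symmetry.
apply: etrans (congr1 (free_lact v) (free_lactU w u)) _.
exact: free_lact_wexp.
Qed.

Lemma free_ractM f v w : free_ract f (v * w) = free_ract (free_ract f v) w.
Proof.
apply: (linear_malg_eq (h1 := free_ract^~ _)
          (h2 := fun f => free_ract (free_ract f v) w)) f => [||u].
- exact: free_ract_linearl.
- exact: (linear_comp (free_ract_linearl w) (free_ract_linearl v)).
transitivity (wexp (wbasis F (word_lst u) * (v * w)) (set_lst u)).
  exact: free_ractU.
rewrite mulrA; symmetry.
apply: etrans (congr1 (free_ract^~ w) (free_ractU v u)) _.
exact: free_ract_wexp.
Qed.

Lemma free_lractA v f w :
  free_ract (free_lact v f) w = free_lact v (free_ract f w).
Proof.
apply: (linear_malg_eq (h1 := fun f => free_ract (free_lact v f) w)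
          (h2 := fun f => free_lact v (free_ract f w))) f => [||u].
- exact: (linear_comp (free_ract_linearl w) (free_lact_linearr v)).
- exact: (linear_comp (free_lact_linearr v) (free_ract_linearl w)).
apply: (wexp_exchange (h1 := free_ract^~ w)
          (k := fun b c => set_lst (set_fst b u) c)
          (free_lactU v u) (free_ractU w u)) => [||b|b].
- exact: free_ract_linearl.
- exact: free_lact_linearr.
- exact: free_ractU.
- exact: free_lactU.
Qed.

Lemma free_lact_mul w f g :
  free_lact w (free_mul f g) = free_mul (free_lact w f) g.
Proof.
apply: (linear_malg_eq (h1 := fun f => free_lact w (free_mul f g))
          (h2 := fun f => free_mul (free_lact w f) g)) f => [||u].
- exact: (linear_comp (free_lact_linearr w) (free_mul_linearl g)).
- exact: (linear_comp (free_mul_linearl g) (free_lact_linearr w)).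
apply: (linear_malg_eq (h1 := fun g => free_lact w (free_mul (bword u) g)))
  g => [||v].
- exact: (linear_comp (free_lact_linearr w) (free_mul_linearr _)).
- exact: free_mul_linearr.
apply: (wexp_exchange (h2 := free_mul^~ (bword v))
          (k := fun b c => set_fst c (word_cat u b v))
          (free_mulUU u v) (free_lactU w u)) => [||b|b].
- exact: free_lact_linearr.
- exact: free_mul_linearl.
- exact: free_lactU.
- exact: free_mulUU.
Qed.

Lemma free_ract_mul f g w :
  free_ract (free_mul f g) w = free_mul f (free_ract g w).
Proof.
apply: (linear_malg_eq (h1 := fun f => free_ract (free_mul f g) w)
          (h2 := free_mul^~ (free_ract g w))) f => [||u].
- exact: (linear_comp (free_ract_linearl w) (free_mul_linearl g)).
- exact: free_mul_linearl.
apply: (linear_malg_eq (h1 := fun g => free_ract (free_mul (bword u) g) w)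
          (h2 := fun g => free_mul (bword u) (free_ract g w))) g => [||v].
- exact: (linear_comp (free_ract_linearl w) (free_mul_linearr _)).
- exact: (linear_comp (free_mul_linearr _) (free_ract_linearl w)).
apply: (wexp_exchange (h1 := free_ract^~ w)
          (k := fun b c => set_lst (word_cat u b v) c)
          (free_mulUU u v) (free_ractU w v)) => [||b|b].
- exact: free_ract_linearl.
- exact: free_mul_linearr.
- exact: free_ractU.
- exact: free_mulUU.
Qed.

Lemma free_mul_ract f w g :
  free_mul (free_ract f w) g = free_mul f (free_lact w g).
Proof.
apply: (linear_malg_eq (h1 := fun f => free_mul (free_ract f w) g)
          (h2 := free_mul^~ (free_lact w g))) f => [||u].
- exact: (linear_comp (free_mul_linearl g) (free_ract_linearl w)).
- exact: free_mul_linearl.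
apply: (linear_malg_eq (h1 := free_mul (free_ract (bword u) w))
  (h2 := fun g => free_mul (bword u) (free_lact w g))) g => [||v].
- exact: free_mul_linearr.
- exact: (linear_comp (free_mul_linearr _) (free_lact_linearr w)).
transitivity (wexp (wbasis F (word_lst u) * w * wbasis F (word_fst v))
                   (fun b => word_cat u b v)).
  apply: etrans (congr1 (free_mul^~ (bword v)) (free_ractU w u)) _.
  apply: (wexp_ext (h := free_mul^~ (bword v))
            (G := fun p => wexp (p * wbasis F (word_fst v)) _)) => [||b].
  - exact: free_mul_linearl.
  - exact: wexp_mulr_linear.
  - exact: free_mulUU.
rewrite -mulrA; symmetry.
apply: etrans (congr1 (free_mul (bword u)) (free_lactU w v)) _.
apply: (wexp_ext (h := free_mul (bword u))
          (G := fun p => wexp (wbasis F (word_lst u) * p) _)) => [||b].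
- exact: free_mul_linearr.
- exact: wexp_mull_linear.
- exact: free_mulUU.
Qed.

Definition freeW : walg F :=
  WAlg free_mulA free_mul_linearl free_mul_linearr free_lact_linearl
    free_lact_linearr free_ract_linearl free_ract_linearr free_lact1 free_ract1
    free_lactM free_ractM free_lractA free_lact_mul free_ract_mul free_mul_ract.

Definition wvar (j : nat) : freeW := bword (0, j, [::], 0).
End FreeWAlgebra.

Section Evaluation.
Variables (F : fieldType) (A : walg F) (a : nat -> A).

(* f(a_0, a_1, ...) *)
Definition weval (f : freeW F) : A :=
  lin_ext (fun u => word_val a (map_word (wbasis F) u)) f.

Lemma weval_linear : linear weval.
Proof. exact: lin_ext_linear. Qed.

Let step (m : A) (p : UT2 F * nat) : A := wmul m (lact p.1 (a p.2)).

Let foldl_wmul (x m : A) s : foldl step (wmul x m) s = wmul x (foldl step m s).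
Proof. by elim: s m => //= p s IH m; rewrite /step -wmulA IH. Qed.

Let foldl_lact w (m : A) s : foldl step (lact w m) s = lact w (foldl step m s).
Proof. by elim: s m => //= p s IH m; rewrite /step -lact_wmul IH. Qed.

Let word_val_cat (u : word (UT2 F)) w v :
  word_val a (word_cat u w v) =
  wmul (ract (foldl step (lact (word_fst u) (a u.1.1.2)) u.1.2) w)
       (word_val a (set_fst 1 v)).
Proof.
rewrite /word_val /= foldl_cat /= foldl_wmul foldl_lact lact1.
by rewrite wmul_ract ract_wmul lractA.
Qed.

Let word_val_fst (u : word (UT2 F)) w :
  word_val a (set_fst w u) = lact w (word_val a (set_fst 1 u)).
Proof. by rewrite /word_val /= !foldl_lact lact1 lractA. Qed.

Let word_val_lst (u : word (UT2 F)) w :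
  word_val a (set_lst u w) = ract (word_val a (set_lst u 1)) w.
Proof. by rewrite /word_val /= ract1. Qed.

Let weval_bword u : weval (bword F u) = word_val a (map_word (wbasis F) u).
Proof. exact: lin_extU. Qed.

(* weval is the morphism of W-algebras that sends the j-th variable to a j.    *)
Lemma weval_var j : weval (wvar F j) = a j.
Proof.
rewrite weval_bword /word_val /= /wbasis (tnth_nth 0) /=.
by rewrite lact1 ract1.
Qed.

Lemma weval_lact w f : weval (lact w f) = lact w (weval f).
Proof.
apply: (linear_malg_eq (h1 := fun f => weval (free_lact w f))
          (h2 := fun f => lact w (weval f))) f => [||u].
- exact: (linear_comp weval_linear (free_lact_linearr w)).
- exact: (linear_comp (@lact_linearr _ A w) weval_linear).
apply: etrans (congr1 weval (free_lactU w u)) _.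
apply: etrans (esym (congr1 (@lact _ A w) (weval_bword u))).
have -> : map_word (wbasis F) u =
    set_fst (wbasis F (word_fst u)) (map_word (wbasis F) u) by [].
rewrite word_val_fst -lactM.
apply: (wexp_ext (h := weval) (G := @lact _ A ^~ _)) => [||b].
- exact: weval_linear.
- exact: lact_linearl.
- by rewrite weval_bword -word_val_fst.
Qed.

Lemma weval_ract f w : weval (ract f w) = ract (weval f) w.
Proof.
apply: (linear_malg_eq (h1 := fun f => weval (free_ract f w))
          (h2 := fun f => ract (weval f) w)) f => [||u].
- exact: (linear_comp weval_linear (free_ract_linearl w)).
- exact: (linear_comp (@ract_linearl _ A w) weval_linear).
apply: etrans (congr1 weval (free_ractU w u)) _.
apply: etrans (esym (congr1 (@ract _ A ^~ w) (weval_bword u))).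
have -> : map_word (wbasis F) u =
    set_lst (map_word (wbasis F) u) (wbasis F (word_lst u)) by [].
rewrite word_val_lst -ractM.
apply: (wexp_ext (h := weval) (G := @ract _ A _)) => [||b].
- exact: weval_linear.
- exact: ract_linearr.
- by rewrite weval_bword -word_val_lst.
Qed.

Lemma weval_mul f g : weval (wmul f g) = wmul (weval f) (weval g).
Proof.
apply: (linear_malg_eq (h1 := fun f => weval (free_mul f g))
          (h2 := fun f => wmul (weval f) (weval g))) f => [||u].
- exact: (linear_comp weval_linear (free_mul_linearl g)).
- exact: (linear_comp (@wmul_linearl _ A _) weval_linear).
apply: (linear_malg_eq (h1 := fun g => weval (free_mul (bword F u) g))
          (h2 := fun g => wmul (weval (bword F u)) (weval g))) g => [||v].
- exact: (linear_comp weval_linear (free_mul_linearr _)).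
- exact: (linear_comp (@wmul_linearr _ A _) weval_linear).
transitivity (weval (wexp (wbasis F (word_lst u) * wbasis F (word_fst v))
                          (fun b => word_cat u b v))).
  by congr weval; apply: free_mulUU.
symmetry.
apply: etrans (congr2 (@wmul _ A) (weval_bword u) (weval_bword v)) _; symmetry.
have -> : map_word (wbasis F) v =
    set_fst (wbasis F (word_fst v)) (map_word (wbasis F) v) by [].
set U := map_word _ u; set V := map_word _ v.
rewrite word_val_fst -wmul_ract.
set m := foldl step (lact (word_fst U) (a U.1.1.2)) U.1.2.
have -> : word_val a U = ract m (wbasis F (word_lst u)) by [].
rewrite -ractM.
apply: (wexp_ext (h := weval)
          (G := fun p => wmul (ract m p) (word_val a (set_fst 1 V)))) => [||b].
- exact: weval_linear.
- exact: (linear_comp (@wmul_linearl _ A _) (@ract_linearr _ A m)).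
- rewrite weval_bword -word_val_cat; congr word_val.
  by rewrite /map_word /word_cat /= map_cat.
Qed.

End Evaluation.

Section Identities.
Variable F : fieldType.

(* GId(A) *)
Definition gid (A : walg F) : set (freeW F) :=
  [set f | forall a : nat -> A, weval a f = 0].

(* Classes of W-algebras are predicates; walg F is too large for set (walg F). *)
Definition wclass := walg F -> Prop.

(* GId of a class of W-algebras *)
Definition class_gid (V : wclass) : set (freeW F) :=
  [set f | forall A, V A -> gid A f].

Definition gvariety (V : wclass) : Prop :=
  exists S : set (freeW F), forall A, V A <-> S `<=` gid A.

Definition gvar (A : walg F) : wclass := fun B => gid A `<=` gid B.

Lemma gvariety_gvar A : gvariety (gvar A).
Proof. by exists (gid A). Qed.

Lemma class_gid_gvar A : class_gid (gvar A) = gid A.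
Proof.
apply/seteqP; split=> [f Vf|f Af B AB]; last exact: AB.
by apply: Vf => g.
Qed.

Definition proper_gsubvariety (U V : wclass) : Prop :=
  [/\ gvariety U, forall A, U A -> V A & exists2 A, V A & ~ U A].

Definition lin_span (V : lmodType F) (S : set V) : set V :=
  [set v | exists k (c : 'I_k -> F) (b : 'I_k -> V),
     (forall i, S (b i)) /\ v = \sum_i c i *: b i].

(* the words w_0 x_(s 1) w_1 ... w_(n-1) x_(s n) w_n of W<X>, with arbitrary   *)
(* coefficients w_i in W and s a permutation                                   *)
Definition multilinear_words (n : nat) : set (freeW F) :=
  [set word_val (wvar F) u
     | u in [set u : word (UT2 F) | perm_eq (letters u) (iota 0 n)]].

(* GP_n *)
Definition GP (n : nat) : set (freeW F) := lin_span (multilinear_words n).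

(* d = dim P / Q, for subspaces Q <= P of V: some family b of d vectors of P  *)
(* induces a basis of P / Q                                                    *)
Definition is_quot_dim (V : lmodType F) (P Q : set V) (d : nat) : Prop :=
  exists b : 'I_d -> V,
    [/\ forall i, P (b i),
        forall c : 'I_d -> F, Q (\sum_i c i *: b i) -> forall i, c i = 0
      & forall v, P v -> exists c : 'I_d -> F, Q (v - \sum_i c i *: b i)].

(* the default value 0 is only used when P / Q is infinite-dimensional        *)
Definition quot_dim (V : lmodType F) (P Q : set V) : nat :=
  xget 0%N [set d | is_quot_dim P Q d].

Lemma is_quot_dim_le (V : lmodType F) (P Q : set V) d e
    (b : 'I_d -> V) (g : 'I_e -> V) :
  lin_span Q `<=` Q -> (forall i, P (b i)) ->
  (forall c : 'I_d -> F, Q (\sum_i c i *: b i) -> forall i, c i = 0) ->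
  (forall v, P v -> exists c : 'I_e -> F, Q (v - \sum_i c i *: g i)) ->
  (d <= e)%N.
Proof.
move=> spanQ Pb freeb /(_ _ (Pb _)) gen_b.
have /choice[c Qc] := gen_b; pose C : 'M[F]_(d, e) := \matrix_(i, j) c i j.
rewrite leqNgt; apply/negP => lt_ed.
have: kermx C != 0.
  by rewrite kermx_eq0 /row_free ltn_eqF // (leq_ltn_trans (rank_leq_col C)).
case/rowV0Pn=> v /sub_kermxP vC0 /negP[]; apply/eqP/rowP => i.
rewrite mxE; apply: freeb i => /=; apply: spanQ.
exists d, (v 0), (fun i => b i - \sum_j c i j *: g j); split=> //.
under [RHS]eq_bigr do rewrite scalerBr.
rewrite sumrB -[LHS]subr0; congr (_ - _).
under eq_bigr do rewrite scaler_sumr.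
rewrite exchange_big big1 // => j _ /=.
under eq_bigr do rewrite scalerA.
rewrite -scaler_suml; have /rowP/(_ j) := vC0; rewrite !mxE => vC.
by under eq_bigr => k _ do rewrite -[c k j](mxE matrix_key (fun k j => c k j));
  rewrite vC scale0r.
Qed.

Lemma is_quot_dim_uniq (V : lmodType F) (P Q : set V) d e :
  lin_span Q `<=` Q -> is_quot_dim P Q d -> is_quot_dim P Q e -> d = e.
Proof.
move=> spanQ [b [Pb freeb genb]] [g [Pg freeg geng]]; apply/eqP.
by rewrite eqn_leq (is_quot_dim_le spanQ Pb freeb geng)
  (is_quot_dim_le spanQ Pg freeg genb).
Qed.

Lemma is_quot_dim_ex (V : lmodType F) (P Q : set V) k (g : 'I_k -> V) :
  lin_span Q `<=` Q ->
  (forall v, P v -> exists c : 'I_k -> F, Q (v - \sum_i c i *: g i)) ->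
  is_quot_dim P Q (quot_dim P Q).
Proof.
move=> spanQ geng; rewrite /quot_dim.
suff [d Pd] : exists d, is_quot_dim P Q d by apply: (xgetPex 0%N); exists d.
pose indep d := `[< exists b : 'I_d -> V, (forall i, P (b i)) /\
  forall c : 'I_d -> F, Q (\sum_i c i *: b i) -> forall i, c i = 0 >].
have ex_d : exists d, indep d.
  by exists 0%N; apply/asboolP; exists (fun=> 0); split=> [[]|c _ []].
have le_d d : indep d -> (d <= k)%N.
  by move=> /asboolP[b [Pb freeb]]; apply: is_quot_dim_le geng.
case: (ex_maxnP ex_d le_d) => d /asboolP[b [Pb freeb]] max_d.
exists d, b; split=> // v Pv; apply: contrapT => no_c.
suff /max_d : indep d.+1 by rewrite ltnn.
apply/asboolP; exists (fun i => oapp b v (unlift ord0 i)); split.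
  by move=> i; case: unliftP => [j|] _ /=.
move=> c; rewrite big_ord_recl unlift_none /=.
under eq_bigr do rewrite liftK /=.
move=> Qc.
have [c0|c0] := eqVneq (c ord0) 0.
  move: Qc; rewrite c0 scale0r add0r => /freeb cl i.
  by case: (unliftP ord0 i) => [j|] -> //; apply: cl.
case: no_c; exists (fun i => - (c ord0)^-1 * c (lift ord0 i)).
apply: spanQ.
exists 1%N, (fun=> (c ord0)^-1),
  (fun=> c ord0 *: v + \sum_(i < d) c (lift ord0 i) *: b i).
split=> //; rewrite big_ord1 scalerDr scalerA mulVf // scale1r; congr (_ + _).
rewrite scaler_sumr -sumrN; apply: eq_bigr => i _.
by rewrite scalerA mulNr scaleNr opprK.
Qed.

(* gc_n *)
Definition gcodim (V : wclass) (n : nat) : nat :=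
  quot_dim (GP n) (GP n `&` class_gid V).

Definition poly_growth (V : wclass) : Prop :=
  exists C k : nat, forall n, (0 < n)%N -> (gcodim V n <= C * n ^ k)%N.

Definition almost_poly_growth (V : wclass) : Prop :=
  ~ poly_growth V /\
  forall U : wclass, proper_gsubvariety U V -> poly_growth U.

End Identities.

Section UT2D.
Variable F : fieldType.

(* w acts on UT2^D as its component on 1 and e22.                              *)
Definition dpart (w : UT2 F) : UT2 F :=
  wcoord w 0 *: wbasis F 0 + wcoord w 1 *: wbasis F 1.

Definition lactD (w a : UT2 F) : UT2 F := dpart w * a.
Definition ractD (a w : UT2 F) : UT2 F := a * dpart w.

Lemma dpart_linear : linear dpart.
Proof.
move=> c v w; rewrite /dpart (wcoord_linear 0) (wcoord_linear 1).
move: (wcoord v 0) (wcoord v 1) (wcoord w 0) (wcoord w 1) => x y x' y'.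
by rewrite !scalerDl [in RHS](scalerDr c) !(scalerA c) addrACA.
Qed.

Let dpartE w : [/\ dpart w 0 0 = w 0 0, dpart w 1 1 = w 1 1 & dpart w 0 1 = 0].
Proof.
rewrite /dpart /wcoord /wbasis !(tnth_nth 0) /= !mxE /=.
by rewrite !mulr1 !mulr0 !addr0 addrC subrK.
Qed.

Let UT2_eq (v w : UT2 F) :
  v 0 0 = w 0 0 -> v 1 1 = w 1 1 -> v 0 1 = w 0 1 -> v = w.
Proof.
move=> E0 E1 E01; rewrite [v]wcoordE [w]wcoordE; apply: eq_bigr => b _.
by rewrite /wcoord E0 E1 E01.
Qed.

Let UT2_mulE (v w : UT2 F) :
  (v * w) 0 0 = v 0 0 * w 0 0 /\ (v * w) 1 1 = v 1 1 * w 1 1.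
Proof.
have := valP v; have := valP w; rewrite !upper_trigE => /eqP w10 /eqP v10.
rewrite /= !mxE !big_ord_recl !big_ord0.
have -> : lift ord0 ord0 = 1 :> 'I_2 by apply: val_inj.
by rewrite w10 v10 mulr0 mul0r !addr0 add0r.
Qed.

Let UT2_mul01 (v w : UT2 F) : (v * w) 0 1 = v 0 0 * w 0 1 + v 0 1 * w 1 1.
Proof.
rewrite /= !mxE !big_ord_recl !big_ord0 addr0.
by have -> : lift ord0 ord0 = 1 :> 'I_2 by apply: val_inj.
Qed.

Lemma dpart1 : dpart 1 = 1.
Proof.
by have [E0 E1 E01] := dpartE 1; apply: UT2_eq; rewrite ?E0 ?E1 ?E01 //= mxE.
Qed.

Lemma dpartM v w : dpart (v * w) = dpart v * dpart w.
Proof.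
have [v0 v1 v01] := dpartE v; have [w0 w1 w01] := dpartE w.
have [p0 p1 p01] := dpartE (v * w); have [m0 m1] := UT2_mulE v w.
have [d0 d1] := UT2_mulE (dpart v) (dpart w).
apply: UT2_eq.
- by rewrite p0 m0 d0 v0 w0.
- by rewrite p1 m1 d1 v1 w1.
- by rewrite p01 UT2_mul01 v01 w01 mulr0 mul0r addr0.
Qed.

Let dpart_e : dpart (e22 F) = e22 F /\ dpart (e12 F) = 0.
Proof.
have := dpartE (e22 F); have := dpartE (e12 F).
by case=> a1 a2 a3 [b1 b2 b3]; split; apply: UT2_eq;
  rewrite ?a1 ?a2 ?a3 ?b1 ?b2 ?b3 //= !mxE.
Qed.

Let mul_linearl (b : UT2 F) : linear (fun a : UT2 F => a * b).
Proof. by move=> c x y; rewrite mulrDl scalerAl. Qed.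
Let mul_linearr (a : UT2 F) : linear (fun b : UT2 F => a * b).
Proof. by move=> c x y; rewrite mulrDr scalerAr. Qed.
Let lactD_linearl a : linear (lactD^~ a).
Proof. exact: (linear_comp (mul_linearl a) dpart_linear). Qed.
Let ractD_linearr a : linear (ractD a).
Proof. exact: (linear_comp (mul_linearr a) dpart_linear). Qed.
Let lactD1 a : lactD 1 a = a.
Proof. by rewrite /lactD dpart1 mul1r. Qed.
Let ractD1 a : ractD a 1 = a.
Proof. by rewrite /ractD dpart1 mulr1. Qed.
Let lactDM v w a : lactD (v * w) a = lactD v (lactD w a).
Proof. by rewrite /lactD dpartM mulrA. Qed.
Let ractDM a v w : ractD a (v * w) = ractD (ractD a v) w.
Proof. by rewrite /ractD dpartM mulrA. Qed.
Let lractDA v a w : ractD (lactD v a) w = lactD v (ractD a w).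
Proof. by rewrite /ractD /lactD mulrA. Qed.
Let lactD_mul w a b : lactD w (a * b) = lactD w a * b.
Proof. exact: mulrA. Qed.
Let ractD_mul a b w : ractD (a * b) w = a * ractD b w.
Proof. by rewrite /ractD mulrA. Qed.
Let mul_ractD a w b : ractD a w * b = a * lactD w b.
Proof. by rewrite /ractD /lactD mulrA. Qed.

Definition UT2D : walg F :=
  @WAlg F (UT2 F) *%R lactD ractD (@mulrA _) mul_linearl mul_linearr
    lactD_linearl (fun w => mul_linearr (dpart w))
    (fun w => mul_linearl (dpart w)) ractD_linearr
    lactD1 ractD1 lactDM ractDM lractDA lactD_mul ractD_mul mul_ractD.

Lemma lact_UT2D (a : UT2D) :
  lact (e22 F) a = e22 F * a /\ lact (e12 F) a = 0.
Proof. by have [E22 E12] := dpart_e; split; rewrite /= /lactD ?E22 ?E12 ?mul0r. Qed.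

Lemma ract_UT2D (a : UT2D) :
  ract a (e22 F) = a * e22 F /\ ract a (e12 F) = 0.
Proof. by have [E22 E12] := dpart_e; split; rewrite /= /ractD ?E22 ?E12 ?mulr0. Qed.

End UT2D.

(* Main.v *)
From HB Require Import structures.
Require Import Defs.
From mathcomp Require Import all_boot all_order all_algebra.
From mathcomp Require Import boolp classical_sets.
From mathcomp Require Import finmap monalg ring zify.

(* Modulo the identities of UT2^D, every multilinear word is a combination of  *)
(* the words with all coefficients e11, with all coefficients e22, and of the  *)
(* words e11 x_i1 e11 ... e11 x_j e22 x_k1 e22 ... e22, where the order of the *)
(* letters on each side of x_j is irrelevant; the latter are independent, so   *)
(* the codimensions grow exponentially.  An identity f of a proper subvariety  *)
(* which is not one of UT2^D yields, on substituting combinations of generic   *)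
(* elements of the three Peirce components, an identity T(r, s) m = 0 with T a *)
(* nonzero polynomial in commuting r and s.  In characteristic 0 polarization  *)
(* of T turns its leading term into r_1 ... r_n m s_1 ... s_m' = 0, so only    *)
(* words with fewer than n letters before x_j, or fewer than m' after it,      *)
(* survive: polynomially many.                                                 *)

Set Implicit Arguments.
Unset Strict Implicit.
Unset Printing Implicit Defensive.

Import GRing.Theory.
Local Open Scope ring_scope.

(** On [UT2D] a coefficient acts only through its diagonal. The value of a word is thus a matrix
    product whose diagonal entries are products of diagonal entries of the arguments, and whose
    corner is a sum over the letter at which the product switches from the first diagonal entry to
    the second. So modulo identities a multilinear word combines [monR], [monS] and the [monM]
    ([word_expand]), and a [monM] depends only on its switching letter and on the set of letters
    before it. Fixing the switching letter leaves 2^n independent words in degree n+1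
    ([gvar_UT2D_exp_growth]).

    If a proper subvariety satisfies some f that is nonzero at a point of [UT2D], substituting along
    the Peirce components and moving a nonzero entry into the corner gives an identity T(r, s) m = 0
    ([exists_poly_identity]). Alternating sums over sets of letters ([sum_sign_horner2]) extract the
    leading term of T with a factor n! q!, invertible in characteristic zero. Hence one [monM] with
    n letters before the switch and q after it is an identity ([exists_monM_identity]), and so is
    every [monM] at least as long on both sides ([monM_identity]). A surviving [monM] has a short
    side, for which there are polynomially many choices; [GP_quot] turns this count into a bound on
    the codimension. *)

(** * Polarization by alternating sums over subsets *)

Section Polarization.
Variable R : comNzRingType.

(** Expand the power over maps f from ['I_p] to ['I_n]. The signed count of the sets A containing
    the image of f vanishes unless f is onto; for p < n no f is onto, and for p = n the onto maps
    are the n! permutations. *)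
Lemma sum_sign_exp_subset n p (x : 'I_n -> R) : (p <= n)%N ->
  \sum_(A : {set 'I_n}) (-1) ^+ #|A| * (\sum_(i in A) x i) ^+ p =
  ((-1) ^+ n * n`!%:R * \prod_i x i) *+ (p == n).
Proof.
move=> le_pn.
have distr (A : {set 'I_n}) : (\sum_(i in A) x i) ^+ p =
    \sum_(f : {ffun 'I_p -> 'I_n}) \prod_k (x (f k) *+ (f k \in A)).
  rewrite -(bigA_distr_bigA (fun (k : 'I_p) i => x i *+ (i \in A))).
  rewrite prodr_const card_ord; congr (_ ^+ _).
  by rewrite [LHS]big_mkcond; apply: eq_bigr => i _; case: ifP.
have sgn (f : {ffun 'I_p -> 'I_n}) :
    \sum_(A : {set 'I_n}) (-1) ^+ #|A| * \prod_k (x (f k) *+ (f k \in A)) =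
    (\prod_k x (f k)) * \prod_i (-1 + (i \notin codom f)%:R).
  rewrite bigA_distr mulr_sumr; apply: eq_bigr => A _.
  have [fA|] := boolP [forall k, f k \in A].
    rewrite mulrC; congr (_ * _).
      by apply: eq_bigr => k _; rewrite (forallP fA).
    rewrite -prodr_const big_mkcond; apply: eq_bigr => i _.
    case: ifPn => // iA; suff -> : i \notin codom f by [].
    by apply: contra iA => /codomP[k ->]; apply: (forallP fA).
  rewrite negb_forall => /existsP[k fkA].
  rewrite (bigD1 k) //= (negPf fkA) mulr0n mul0r mulr0.
  by rewrite [X in _ * X](bigD1 (f k)) //= (negPf fkA) codom_f mul0r mulr0.
under [LHS]eq_bigr => A _ do rewrite distr mulr_sumr.
rewrite exchange_big /=; under [LHS]eq_bigr => f _ do rewrite sgn.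
have nsurj (f : {ffun 'I_p -> 'I_n}) i : i \notin codom f ->
    \prod_i (-1 + (i \notin codom f)%:R) = 0 :> R.
  by move=> fi; rewrite (bigD1 i) //= fi addNr mul0r.
have [pn|pn] := eqVneq p n; last first.
  rewrite mulr0n big1 // => f _.
  suff [i fi] : exists i, i \notin codom f by rewrite (nsurj _ i) ?mulr0.
  apply/existsP; rewrite -negb_forall; apply/negP => /forallP fs.
  have : (#|'I_n| <= #|codom f|)%N.
    by apply/subset_leq_card/fintype.subsetP => i _.
  rewrite card_ord => /leq_trans/(_ (leq_image_card _ _)); rewrite card_ord.
  by rewrite leqNgt ltn_neqAle pn le_pn.
subst p; rewrite mulr1n.
rewrite (bigID (fun f : {ffun 'I_n -> 'I_n} => injectiveb f)) /=.
rewrite [X in _ + X]big1 ?addr0 => [|f /injectiveP fi]; last first.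
  suff [i ffi] : exists i, i \notin codom f by rewrite (nsurj _ i) ?mulr0.
  apply/existsP; rewrite -negb_forall; apply/negP => /forallP fs.
  apply: fi; apply/injectiveP; apply/card_uniqP.
  rewrite size_codom; apply/eqP; rewrite eqn_leq subset_leq_card; last first.
    by apply/fintype.subsetP.
  by apply/subset_leq_card/fintype.subsetP => i _; apply: fs.
rewrite (eq_bigr (fun=> (-1) ^+ n * \prod_i x i)) => [|f /injectiveP fi].
  rewrite sumr_const; have := card_inj_ffuns 'I_n 'I_n.
  rewrite cardsE !card_ord ffactnn => <-.
  by rewrite -mulrA -[_ * (_%:R * _)]mulrCA mulr_natl.
rewrite mulrC; congr (_ * _).
  rewrite (eq_bigr (fun=> -1)) ?prodr_const ?card_ord // => i _.
  have /codomP[k ->] : i \in codom f by exact: (inj_card_onto fi).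
  by rewrite codom_f addr0.
by rewrite [RHS](reindex f) //=; apply/onW_bij/injF_bij.
Qed.

Lemma sum_sign_horner n (P : {poly R}) (x : 'I_n -> R) : size P = n.+1 ->
  \sum_(A : {set 'I_n}) (-1) ^+ #|A| * P.[ \sum_(i in A) x i] =
  (-1) ^+ n * n`!%:R * lead_coef P * \prod_i x i.
Proof.
move=> sP; under [LHS]eq_bigr => A _ do rewrite horner_coef mulr_sumr.
rewrite exchange_big sP /= big_ord_recr /= big1 ?add0r => [|i _]; last first.
  under [LHS]eq_bigr => A _ do rewrite mulrCA.
  by rewrite -mulr_sumr sum_sign_exp_subset 1?ltnW // ltn_eqF // mulr0.
under [LHS]eq_bigr => A _ do rewrite mulrCA.
rewrite -mulr_sumr sum_sign_exp_subset // eqxx lead_coefE sP /=.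
by rewrite mulr1n mulrCA !mulrA.
Qed.

End Polarization.

(** Polarizing in the outer variable, over the coefficient ring [{poly R}], leaves the leading
    coefficient of [T]; polarizing that in the inner variable leaves its own leading coefficient. *)
Lemma sum_sign_horner2 (R : idomainType) n m (T : {poly {poly R}})
    (x : 'I_n -> R) (y : 'I_m -> R) :
    size T = n.+1 -> size (lead_coef T) = m.+1 ->
  \sum_(A : {set 'I_n}) \sum_(B : {set 'I_m}) (-1) ^+ #|A| * (-1) ^+ #|B| *
    T.[(\sum_(i in A) x i)%:P].[ \sum_(i in B) y i] =
  (-1) ^+ n * n`!%:R * ((-1) ^+ m * m`!%:R) * lead_coef (lead_coef T) *
  (\prod_i x i * \prod_i y i).
Proof.
move=> sT sL; rewrite exchange_big /=.
have E (B : {set 'I_m}) : \sum_(A : {set 'I_n}) (-1) ^+ #|A| * (-1) ^+ #|B| *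
      T.[(\sum_(i in A) x i)%:P].[ \sum_(i in B) y i] =
    (-1) ^+ #|B| * (lead_coef T).[ \sum_(i in B) y i] *
      ((-1) ^+ n * n`!%:R * \prod_i x i).
  have := sum_sign_horner (fun i => (x i)%:P) sT.
  move=> /(congr1 (horner^~ (\sum_(i in B) y i))).
  rewrite /= horner_sum => E; under [LHS]eq_bigr => A _ do rewrite mulrAC.
  rewrite -mulr_suml.
  rewrite mulrC -mulrA; congr (_ * _).
  transitivity (\sum_(A : {set 'I_n})
      ((-1) ^+ #|A| * T.[ \sum_(i in A) (x i)%:P]).[ \sum_(i in B) y i]).
    apply: eq_bigr => A _; rewrite hornerM -rmorph_sum horner_exp hornerN.
    by rewrite hornerC.
  rewrite E -rmorph_prod !hornerM horner_exp hornerN !hornerC.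
  rewrite -polyC_natr hornerC.
  by ring.
rewrite (eq_bigr _ (fun B _ => E B)) -mulr_suml sum_sign_horner //.
by ring.
Qed.

Lemma linear0_eq (F : fieldType) (V W : lmodType F) (h : V -> W) :
  linear h -> h 0 = 0.
Proof.
by move=> l; have := l (-1) 0 0; rewrite scaler0 addr0 scaleN1r addNr.
Qed.

(** * Evaluation of words and substitution *)

Section WordValues.
Variable F : fieldType.
Implicit Type A : walg F.

Lemma word_val_cons A (a : nat -> A) c j q s d :
  word_val a (c, j, q :: s, d) =
  wmul (lact c (a j)) (word_val a (q.1, q.2, s, d)).
Proof.
rewrite /word_val /= -ract_wmul; congr ract.
elim: s (lact q.1 _) => //= p s IH m.
by rewrite -wmulA IH.
Qed.

Lemma weval_word_val A (a : nat -> A) (b : nat -> freeW F) u :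
  weval a (word_val b u) = word_val (fun i => weval a (b i)) u.
Proof.
case: u => [[[c j] s] d]; elim: s c j => [|q s IH] c j.
  by rewrite /word_val /= weval_ract weval_lact.
have -> : word_val b (c, j, q :: s, d) =
  wmul (lact c (b j)) (word_val b (q.1, q.2, s, d)) by exact: word_val_cons.
have := IH q.1 q.2; move: (word_val b _) => f fE.
have -> := @weval_mul F A a (lact c (b j)) f.
by rewrite weval_lact fE word_val_cons.
Qed.

Lemma weval_word A (a : nat -> A) u :
  weval a (word_val (wvar F) u) = word_val a u.
Proof.
by rewrite weval_word_val; congr word_val; apply/funext => i; rewrite weval_var.
Qed.

Lemma weval_comp A (a : nat -> A) (b : nat -> freeW F) f :
  weval a (weval b f) = weval (fun i => weval a (b i)) f.
Proof.
apply: (linear_malg_eq (h1 := fun f => weval a (weval b f))) f => [||u].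
- exact: (linear_comp (weval_linear a) (weval_linear b)).
- exact: weval_linear.
by rewrite /weval !lin_extU -weval_word_val.
Qed.

Lemma weval_big A (a : nat -> A) (I : finType) (c : I -> F) (x : I -> freeW F) :
  weval a (\sum_i c i *: x i) = \sum_i c i *: weval a (x i).
Proof. exact/linear_big/weval_linear. Qed.

Lemma wevalB A (a : nat -> A) (f g : freeW F) :
  weval a (f - g) = weval a f - weval a g.
Proof.
by rewrite addrC -scaleN1r weval_linear scaleN1r addrC.
Qed.

End WordValues.

(** * Matrix entries in UT2 and UT2^D *)

HB.lock Definition ut (F : fieldType) (x y z : F) : UT2 F :=
  x *: (1 - e22 F) + y *: e12 F + z *: e22 F.

Section Entries.
Variable F : fieldType.
Implicit Types v w : UT2 F.

Lemma utE (x y z : F) :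
  [/\ ut x y z 0 0 = x, ut x y z 0 1 = y & ut x y z 1 1 = z].
Proof.
by rewrite unlock; split; rewrite /= !mxE /=
  ?(mulr0, mulr1, subr0, subrr, addr0, add0r).
Qed.

Lemma ut00E (x y z : F) : ut x y z 0 0 = x. Proof. by case: (utE x y z). Qed.
Lemma ut01E (x y z : F) : ut x y z 0 1 = y. Proof. by case: (utE x y z). Qed.
Lemma ut11E (x y z : F) : ut x y z 1 1 = z. Proof. by case: (utE x y z). Qed.

Lemma ut_eq v w : v 0 0 = w 0 0 -> v 0 1 = w 0 1 -> v 1 1 = w 1 1 -> v = w.
Proof.
move=> E0 E01 E1; rewrite [v]wcoordE [w]wcoordE; apply: eq_bigr => b _.
by rewrite /wcoord E0 E1 E01.
Qed.

Lemma ut0 (i j : 'I_2) : (0 : UT2 F) i j = 0. Proof. by rewrite /= mxE. Qed.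

Lemma ut_linear (i j : 'I_2) : linear ((fun v : UT2 F => v i j) : UT2 F -> F^o).
Proof. by move=> c v w; rewrite /= !mxE. Qed.

Lemma ut_sum (i j : 'I_2) (I : Type) (r : seq I) (c : I -> F) (t : I -> UT2 F) :
  (\sum_(k <- r) c k *: t k) i j = \sum_(k <- r) c k * t k i j.
Proof.
elim/big_rec2: _ => [|k x v _ <-]; first exact: ut0.
by have -> := ut_linear i j (c k) (t k) v.
Qed.

Lemma ut_000 : ut 0 0 0 = 0 :> UT2 F.
Proof. by apply: ut_eq; rewrite ut0 ?(ut00E, ut01E, ut11E). Qed.

Lemma utM v w : [/\ (v * w) 0 0 = v 0 0 * w 0 0,
  (v * w) 0 1 = v 0 0 * w 0 1 + v 0 1 * w 1 1 & (v * w) 1 1 = v 1 1 * w 1 1].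
Proof.
have := valP v; have := valP w; rewrite !upper_trigE => /eqP w10 /eqP v10.
rewrite /= !mxE !big_ord_recl !big_ord0.
have -> : lift ord0 ord0 = 1 :> 'I_2 by apply: val_inj.
by rewrite w10 v10 mulr0 mul0r !addr0 add0r.
Qed.

Lemma dpartE w :
  [/\ dpart w 0 0 = w 0 0, dpart w 0 1 = 0 & dpart w 1 1 = w 1 1].
Proof.
rewrite /dpart /wcoord /wbasis !(tnth_nth 0) /= !mxE /=.
by rewrite !mulr1 !mulr0 !addr0 addrC subrK.
Qed.

(** Left action scales the rows by the diagonal of w; the term in [w 0 1] of the usual product is
    absent because e12 acts as zero. *)
Lemma lactDE w (v : UT2D F) :
  [/\ (lact w v : UT2 F) 0 0 = w 0 0 * (v : UT2 F) 0 0,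
  (lact w v : UT2 F) 0 1 = w 0 0 * (v : UT2 F) 0 1
  & (lact w v : UT2 F) 1 1 = w 1 1 * (v : UT2 F) 1 1].
Proof.
have [w0 w01 w1] := dpartE w; have [p0 p01 p1] := utM (dpart w) v.
by split; rewrite ?p0 ?p01 ?p1 ?w0 ?w01 ?w1 ?mul0r ?addr0.
Qed.

Lemma ractDE w (v : UT2D F) :
  [/\ (ract v w : UT2 F) 0 0 = (v : UT2 F) 0 0 * w 0 0,
  (ract v w : UT2 F) 0 1 = (v : UT2 F) 0 1 * w 1 1
  & (ract v w : UT2 F) 1 1 = (v : UT2 F) 1 1 * w 1 1].
Proof.
have [w0 w01 w1] := dpartE w; have [p0 p01 p1] := utM v (dpart w).
by split; rewrite ?p0 ?p01 ?p1 ?w0 ?w01 ?w1 ?mulr0 ?add0r.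
Qed.

Lemma utZD (c x y z x' y' z' : F) : c *: ut x y z + ut x' y' z' =
  ut (c * x + x') (c * y + y') (c * z + z').
Proof.
apply: ut_eq; rewrite ?ut00E ?ut01E ?ut11E.
- by have -> := ut_linear 0 0 c (ut x y z) (ut x' y' z'); rewrite !ut00E.
- by have -> := ut_linear 0 1 c (ut x y z) (ut x' y' z'); rewrite !ut01E.
- by have -> := ut_linear 1 1 c (ut x y z) (ut x' y' z'); rewrite !ut11E.
Qed.

Lemma ut_mul (x y z x' y' z' : F) : ut x y z * ut x' y' z' =
  ut (x * x') (x * y' + y * z') (z * z').
Proof.
have [E0 E01 E1] := utM (ut x y z) (ut x' y' z').
by apply: ut_eq; rewrite ?E0 ?E01 ?E1 !(ut00E, ut01E, ut11E).
Qed.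

Lemma dpart_ut (w : UT2 F) : dpart w = ut (w 0 0) 0 (w 1 1).
Proof.
have [E0 E01 E1] := dpartE w.
by apply: ut_eq; rewrite ?E0 ?E01 ?E1 !(ut00E, ut01E, ut11E).
Qed.

End Entries.

(** * Monomials and their values on UT2^D *)

Definition e11 (F : fieldType) : UT2 F := 1 - e22 F.

(* The value on [::] is junk. *)
Definition mkword (F : fieldType) (s : seq (UT2 F * nat)) (d : UT2 F) :
    word (UT2 F) :=
  if s is p :: s' then (p.1, p.2, s', d) else (1, 0%N, [::], d).

Definition pre (C : Type) (w : C) (l : seq nat) : seq (C * nat) :=
  [seq (w, i) | i <- l].

(* Locked, as unification of two evaluations of such words by unfolding them   *)
(* does not terminate in practice.                                             *)
HB.lock Definition monR (F : fieldType) (l : seq nat) : freeW F :=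
  word_val (wvar F) (mkword (pre (e11 F) l) (e11 F)).
HB.lock Definition monS (F : fieldType) (l : seq nat) : freeW F :=
  word_val (wvar F) (mkword (pre (e22 F) l) (e22 F)).
HB.lock Definition monM (F : fieldType) (l1 : seq nat) (j : nat) (l2 : seq nat)
    : freeW F :=
  word_val (wvar F)
    (mkword (pre (e11 F) l1 ++ (e11 F, j) :: pre (e22 F) l2) (e22 F)).

Section Monomials.
Variable F : fieldType.
Local Notation gidD := (@gid F (UT2D F)).
Local Notation evD a := (@weval F (UT2D F) a).
Local Notation e11 := (e11 F).
Local Notation monR := (monR F).
Local Notation monS := (monS F).
Local Notation monM := (monM F).

Lemma e11E : [/\ e11 0 0 = 1, e11 0 1 = 0 & e11 1 1 = 0].
Proof. by split; rewrite /= !mxE /= ?(subr0, subrr). Qed.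

Lemma e22E : [/\ e22 F 0 0 = 0, e22 F 0 1 = 0 & e22 F 1 1 = 1].
Proof. by split; rewrite /= !mxE. Qed.

(** The value of a word on [UT2D] as an ordinary matrix product, folded from the right so that
    induction peels off the first letter. *)
Definition dval (a : nat -> UT2 F) s (d : UT2 F) : UT2 F :=
  foldr (fun p v => dpart p.1 * a p.2 * v) (dpart d) s.

Lemma letters_mkword (s : seq (UT2 F * nat)) d :
  s != [::] -> letters (mkword s d) = unzip2 s.
Proof. by case: s. Qed.

Lemma mkwordK (u : word (UT2 F)) :
  u = mkword ((u.1.1.1, u.1.1.2) :: u.1.2) u.2.
Proof. by case: u => [[[]]]. Qed.

Lemma word_valD (a : nat -> UT2 F) s d : s != [::] ->
  @word_val F (UT2D F) a (mkword s d) = dval a s d.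
Proof.
case: s => // p s _; elim: s p => [//|q s IH] p.
by rewrite /mkword word_val_cons (IH q).
Qed.

Lemma evD_mkword (a : nat -> UT2 F) s d : s != [::] ->
  evD a (word_val (wvar F) (mkword s d)) = dval a s d.
Proof. by move=> s0; rewrite weval_word word_valD. Qed.

Lemma dval00 a s d :
  dval a s d 0 0 = (\prod_(p <- s) p.1 0 0 * d 0 0) * \prod_(p <- s) a p.2 0 0.
Proof.
elim: s => [|p s IH]; first by rewrite !big_nil mulr1 mul1r; case: (dpartE d).
have [-> _ _] := utM (dpart p.1 * a p.2) (dval a s d).
have [-> _ _] := utM (dpart p.1) (a p.2); have [-> _ _] := dpartE p.1.
rewrite IH !big_cons; ring.
Qed.

Lemma dval11 a s d :
  dval a s d 1 1 = (\prod_(p <- s) p.1 1 1 * d 1 1) * \prod_(p <- s) a p.2 1 1.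
Proof.
elim: s => [|p s IH]; first by rewrite !big_nil mulr1 mul1r; case: (dpartE d).
have [_ _ ->] := utM (dpart p.1 * a p.2) (dval a s d).
have [_ _ ->] := utM (dpart p.1) (a p.2); have [_ _ ->] := dpartE p.1.
rewrite IH !big_cons; ring.
Qed.

Lemma dval01_cons a p s d : dval a (p :: s) d 0 1 =
  p.1 0 0 * (a p.2 0 0 * dval a s d 0 1 + a p.2 0 1 * dval a s d 1 1).
Proof.
have [_ -> _] := utM (dpart p.1 * a p.2) (dval a s d).
have [-> -> _] := utM (dpart p.1) (a p.2); have [-> -> _] := dpartE p.1.
ring.
Qed.

Lemma unzip2_pre (C : Type) (w : C) l : unzip2 (pre w l) = l.
Proof. by rewrite /pre /unzip2 -map_comp map_id. Qed.

Lemma evD_monR (a : nat -> UT2 F) l : l != [::] ->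
  evD a (monR l) = ut (\prod_(i <- l) a i 0 0) 0 0.
Proof.
move=> l0; rewrite monR.unlock evD_mkword; last by case: l l0.
have [x y z] := utE (\prod_(i <- l) a i 0 0) 0 (0 : F).
have [E00 E01 E11] := e11E.
apply: ut_eq; rewrite ?x ?y ?z //.
- by rewrite dval00 E00 mulr1 !big_map [X in X * _]big1 ?mul1r.
- elim: l {l0 x y z} => [|i l IH]; first by case: (dpartE e11).
  by rewrite dval01_cons IH dval11 E11 !(mulr0, mul0r, addr0).
- by rewrite dval11 E11 mulr0 mul0r.
Qed.

Lemma evD_monS (a : nat -> UT2 F) l : l != [::] ->
  evD a (monS l) = ut 0 0 (\prod_(i <- l) a i 1 1).
Proof.
move=> l0; rewrite monS.unlock evD_mkword; last by case: l l0.
have [x y z] := utE 0 0 (\prod_(i <- l) a i 1 1).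
have [E00 E01 E11] := e22E.
apply: ut_eq; rewrite ?x ?y ?z //.
- by rewrite dval00 E00 mulr0 mul0r.
- case: l l0 {x y z} => // i l _.
  by rewrite dval01_cons E00 mul0r.
- by rewrite dval11 E11 mulr1 !big_map [X in X * _]big1 ?mul1r.
Qed.

(** The coefficients force the switch to occur exactly at j. The result is symmetric within each of
    [l1] and [l2], which is why their order never matters later. *)
Lemma evD_monM (a : nat -> UT2 F) l1 j l2 : evD a (monM l1 j l2) =
  ut 0 ((\prod_(i <- l1) a i 0 0) * a j 0 1 * \prod_(i <- l2) a i 1 1) 0.
Proof.
rewrite monM.unlock evD_mkword; last by case: l1.
set m := _ * _; have [x y z] := utE 0 m 0.
have [E00 E01 E11] := e22E; have [D00 D01 D11] := e11E.
apply: ut_eq; rewrite ?x ?y ?z //.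
- by rewrite dval00 E00 mulr0 mul0r.
- rewrite /m {x y z m}; elim: l1 => [|i l1 IH].
    rewrite big_nil mul1r dval01_cons D00 mul1r dval11 E11 mulr1 !big_map.
    rewrite [\prod_(i <- l2) (e22 F, i).1 1 1]big1 => [|i _]; last exact: E11.
    have -> : dval a (pre (e22 F) l2) (e22 F) 0 1 = 0.
      case: l2 => [|i l2]; first by case: (dpartE (e22 F)).
      by rewrite dval01_cons E00 mul0r.
    by rewrite mulr0 add0r mul1r.
  rewrite dval01_cons IH D00 mul1r dval11 big_cat /= big_cons /= D11.
  by rewrite !(mul0r, mulr0) addr0 big_cons !mulrA.
- by rewrite dval11 big_cat /= big_cons /= D11 !(mul0r, mulr0).
Qed.

Lemma gidDP f g : (forall a : nat -> UT2 F, evD a f = evD a g) -> gidD (f - g).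
Proof. by move=> fg a; rewrite wevalB fg subrr. Qed.

Lemma dval01 s d : exists c : nat -> F, forall a, dval a s d 0 1 =
  \sum_(k < size s) c k * ((\prod_(i <- take k (unzip2 s)) a i 0 0) *
    a (nth 0%N (unzip2 s) k) 0 1 * \prod_(i <- drop k.+1 (unzip2 s)) a i 1 1).
Proof.
elim: s => [|p s [c IH]].
  by exists (fun=> 0) => a; rewrite big_ord0; case: (dpartE d).
(* Switching at the first letter makes all later coefficients contribute their second diagonal
   entry; otherwise the switch happens further on. *)
pose c' k := if k is k'.+1 then p.1 0 0 * c k'
             else p.1 0 0 * (\prod_(p <- s) p.1 1 1 * d 1 1).
exists c' => a; rewrite dval01_cons IH dval11 big_ord_recl /=.
rewrite big_nil drop0 mul1r mulrDr addrC; congr (_ + _).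
  by rewrite /unzip2 big_map; ring.
rewrite !mulr_sumr; apply: eq_bigr => k _.
by rewrite big_cons /=; ring.
Qed.

(* Modulo the identities of UT2^D, a word expands over the positions at which  *)
(* its coefficients switch from e11 to e22.                                    *)
Lemma word_expand s d : s != [::] -> exists c1 c2 (c : nat -> F),
  gidD (word_val (wvar F) (mkword s d) -
    (c1 *: monR (unzip2 s) + (c2 *: monS (unzip2 s) +
     \sum_(k < size s) c k *: monM (take k (unzip2 s)) (nth 0%N (unzip2 s) k)
       (drop k.+1 (unzip2 s))))).
Proof.
move=> s0; have [c cE] := dval01 s d.
exists (\prod_(p <- s) p.1 0 0 * d 0 0), (\prod_(p <- s) p.1 1 1 * d 1 1), c.
apply: gidDP => a; have l0 : unzip2 s != [::] by case: (s) s0.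
rewrite weval_linear [X in _ = _ + X]weval_linear weval_big.
rewrite (evD_mkword a d s0) (evD_monR a l0) (evD_monS a l0).
under [X in _ = _ + (_ + X)]eq_bigr => k _ do rewrite evD_monM.
have E (i j : 'I_2) (k1 k2 : F) (v w : UT2 F) (m : 'I_(size s) -> F)
      (t : 'I_(size s) -> UT2 F) :
    (k1 *: v + (k2 *: w + \sum_k m k *: t k)) i j =
    k1 * v i j + (k2 * w i j + \sum_k m k * t k i j).
  have -> := ut_linear i j k1 v _; have -> := ut_linear i j k2 w _.
  by rewrite ut_sum.
apply: ut_eq; rewrite E.
- rewrite !ut00E mulr0 add0r dval00 /unzip2 big_map [X in _ + X]big1 ?addr0 //.
  by move=> k _; rewrite ut00E mulr0.
- rewrite !ut01E !mulr0 !add0r cE.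
  by apply: eq_bigr => k _; rewrite ut01E.
- rewrite !ut11E mulr0 add0r dval11 /unzip2 big_map [X in _ + X]big1 ?addr0 //.
  by move=> k _; rewrite ut11E mulr0.
Qed.

End Monomials.

(** * Subspaces, spans modulo a subspace, quotient dimension *)

Section Span.
Variables (F : fieldType) (V : lmodType F).
Implicit Types P Q S : set V.
Local Open Scope classical_set_scope.

Definition subspace Q := Q 0 /\ forall c x y, Q x -> Q y -> Q (c *: x + y).

Lemma subspace_sum Q (I : Type) (r : seq I) (c : I -> F) (x : I -> V) :
  subspace Q -> (forall i, Q (x i)) -> Q (\sum_(i <- r) c i *: x i).
Proof.
by move=> [Q0 Ql] Qx; elim/big_rec: _ => // i y _ Qy; apply: Ql.
Qed.

Lemma subspace_span Q : subspace Q -> lin_span Q `<=` Q.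
Proof. by move=> sQ v [k [c [b [Qb ->]]]]; apply: subspace_sum. Qed.

Lemma sub_lin_span S : S `<=` lin_span S.
Proof.
move=> v Sv; exists 1%N, (fun=> 1), (fun=> v); split=> //.
by rewrite big_ord1 scale1r.
Qed.

Lemma lin_span_subspace S : subspace (lin_span S).
Proof.
split=> [|c _ _ [k [x [b [Sb ->]]]] [m [y [d [Sd ->]]]]].
  by exists 0%N, (fun=> 0), (fun=> 0); split=> [[]|] //; rewrite big_ord0.
exists (k + m)%N,
  (fun i => match split i with inl j => c * x j | inr j => y j end),
  (fun i => match split i with inl j => b j | inr j => d j end).
split=> [i|]; first by case: (split i).
rewrite big_split_ord /= scaler_sumr; congr (_ + _); apply: eq_bigr => i _.
  by rewrite (unsplitK (inl i)) scalerA.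
by rewrite (unsplitK (inr i)).
Qed.

Lemma subspaceI P Q : subspace P -> subspace Q -> subspace (P `&` Q).
Proof.
by move=> [P0 Pl] [Q0 Ql]; split=> // c x y [? ?] [? ?]; split; auto.
Qed.

Definition span_mod Q (I : finType) (g : I -> V) : set V :=
  [set v | exists c : I -> F, Q (v - \sum_i c i *: g i)].

Lemma span_mod_subspace Q (I : finType) (g : I -> V) :
  subspace Q -> subspace (span_mod Q g).
Proof.
move=> [Q0 Ql]; split=> [|k x y [c Qx] [d Qy]].
  by exists (fun=> 0); rewrite big1 ?subr0 // => i _; rewrite scale0r.
exists (fun i => k * c i + d i); have := Ql k _ _ Qx Qy; congr Q.
under [in RHS]eq_bigr => i _ do rewrite scalerDl -scalerA.
by rewrite big_split /= -scaler_sumr scalerBr opprD addrACA.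
Qed.

Lemma span_mod_sub Q (I : finType) (g : I -> V) : Q `<=` span_mod Q g.
Proof.
move=> v Qv; exists (fun=> 0); rewrite big1 ?subr0 // => i _.
by rewrite scale0r.
Qed.

Lemma span_mod_eq Q (I : finType) (g : I -> V) i v :
  Q (v - g i) -> span_mod Q g v.
Proof.
move=> Qv; exists (fun j => (j == i)%:R); rewrite (bigD1 i) //= eqxx scale1r.
by rewrite big1 ?addr0 // => j /negPf ->; rewrite scale0r.
Qed.

(** A finite generating family guarantees that [quot_dim] is an actual dimension and not its default
    value. *)
Lemma quot_dim_le P Q (I : finType) (g : I -> V) :
  subspace Q -> P `<=` span_mod Q g ->
  is_quot_dim P Q (quot_dim P Q) /\ (quot_dim P Q <= #|I|)%N.
Proof.
move=> sQ gen.
have gen' v : P v -> exists c : 'I_#|I| -> F,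
    Q (v - \sum_i c i *: g (enum_val i)).
  move=> /gen[c Qv]; exists (c \o enum_val); move: Qv; congr (Q (_ - _)).
  by rewrite (reindex _ (onW_bij _ (enum_val_bij I))).
have dimP := is_quot_dim_ex (subspace_span sQ) gen'.
split=> //; have [b [Pb freeb _]] := dimP.
exact: is_quot_dim_le (subspace_span sQ) Pb freeb gen'.
Qed.

End Span.

(** * Generators of the multilinear elements *)

Section Codimension.
Variable F : fieldType.
Local Open Scope classical_set_scope.
Local Notation gidD := (@gid F (UT2D F)).

Lemma class_gid_subspace (U : wclass F) : subspace (class_gid U).
Proof.
split=> [A _ a|c f g Uf Ug A UA a].
  exact/linear0_eq/weval_linear.
by rewrite weval_linear (Uf A UA a) (Ug A UA a) scaler0 addr0.
Qed.

Lemma GP_mkword n s d : (0 < n)%N -> perm_eq (unzip2 s) (iota 0 n) ->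
  GP n (word_val (wvar F) (mkword s d)).
Proof.
move=> n0 ps; apply: sub_lin_span; exists (mkword s d) => //=.
have s0 : s != [::].
  by case: s ps => // /perm_size; rewrite size_iota => n0'; rewrite -n0' in n0.
by rewrite letters_mkword.
Qed.

Lemma GP_monR n l : (0 < n)%N -> perm_eq l (iota 0 n) -> GP n (monR F l).
Proof.
by move=> n0 p; rewrite unlock; apply: GP_mkword; rewrite ?unzip2_pre.
Qed.

Lemma GP_monS n l : (0 < n)%N -> perm_eq l (iota 0 n) -> GP n (monS F l).
Proof.
by move=> n0 p; rewrite unlock; apply: GP_mkword; rewrite ?unzip2_pre.
Qed.

Lemma GP_monM n l1 j l2 : (0 < n)%N -> perm_eq (l1 ++ j :: l2) (iota 0 n) ->
  GP n (monM F l1 j l2).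
Proof.
move=> n0 p; rewrite unlock; apply: GP_mkword => //.
by rewrite /unzip2 map_cat /= -!/(unzip2 _) !unzip2_pre.
Qed.

Section Generators.
Variables (n : nat) (K : finType) (t : K -> pred nat).
Local Open Scope nat_scope.

(** The predicate [t k] selects the letters placed before j; listing each block increasingly picks
    one representative of all its orderings. *)
Definition genM (k : K) (j : nat) : freeW F :=
  monM F [seq i <- iota 0 n | (i != j) && t k i] j
         [seq i <- iota 0 n | (i != j) && ~~ t k i].

Definition gen (x : bool + K * 'I_n) : freeW F :=
  match x with
  | inl b => if b then monR F (iota 0 n) else monS F (iota 0 n)
  | inr (k, j) => genM k j
  end.

Lemma perm_genM k j : j < n ->
  perm_eq ([seq i <- iota 0 n | (i != j) && t k i] ++
           j :: [seq i <- iota 0 n | (i != j) && ~~ t k i]) (iota 0 n).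
Proof.
move=> jn; have jI : j \in iota 0 n by rewrite mem_iota.
have E (p : pred nat) : [seq i <- iota 0 n | (i != j) && p i] =
    filter p (rem j (iota 0 n)).
  rewrite rem_filter ?iota_uniq // -filter_predI; apply: eq_filter => i /=.
  by rewrite andbC.
rewrite !E -[j :: _]cat1s perm_catCA (permPr (perm_to_rem jI)) perm_cons.
by apply/permPl/(perm_filterC (t k)).
Qed.

End Generators.

(** The index type K need only describe the left blocks of those [monM] that are not already in J.
    All subsets serve for the lower bound, a small K for the upper bound. *)
Lemma GP_quot n J (K : finType) (t : K -> pred nat) : (0 < n)%N ->
    subspace J -> gidD `<=` J ->
    (forall l1 j l2, perm_eq (l1 ++ j :: l2) (iota 0 n) ->
       J (monM F l1 j l2) \/
       exists k, forall i, (i < n)%N -> i != j -> t k i = (i \in l1)) ->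
  is_quot_dim (GP n) (GP n `&` J) (quot_dim (GP n) (GP n `&` J)) /\
  (quot_dim (GP n) (GP n `&` J) <= 2 + #|K| * n)%N.
Proof.
move=> n0 sJ IJ cov; set Q := GP n `&` J.
have sG : subspace (@GP F n) by apply: lin_span_subspace.
have sQ : subspace Q by apply: subspaceI.
have <- : #|{: bool + K * 'I_n}| = (2 + #|K| * n)%N.
  by rewrite card_sum card_bool card_prod card_ord.
apply: (quot_dim_le (g := gen t) sQ) => v.
have sS := span_mod_subspace (gen (n := n) t) sQ.
have GB (x y : freeW F) : GP n x -> GP n y -> GP n (x - y).
  by move=> Gx Gy; have := sG.2 (-1) y x Gy Gx; rewrite scaleN1r addrC.
have n0l l : perm_eq l (iota 0 n) -> l != [::].
  by case: l => // /perm_size; rewrite size_iota => n0'; rewrite -n0' in n0.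
have SR l : perm_eq l (iota 0 n) -> span_mod Q (gen (n := n) t) (monR F l).
  move=> pl; apply: (span_mod_eq (i := inl true)); split.
    by apply: GB; apply: GP_monR.
  apply/IJ/gidDP => a; rewrite !evD_monR ?n0l //.
  by rewrite (perm_big _ pl).
have SS l : perm_eq l (iota 0 n) -> span_mod Q (gen (n := n) t) (monS F l).
  move=> pl; apply: (span_mod_eq (i := inl false)); split.
    by apply: GB; apply: GP_monS.
  apply/IJ/gidDP => a; rewrite !evD_monS ?n0l //.
  by rewrite (perm_big _ pl).
have SM l1 j l2 : perm_eq (l1 ++ j :: l2) (iota 0 n) ->
    span_mod Q (gen (n := n) t) (monM F l1 j l2).
  move=> pl; have GM := GP_monM n0 pl.
  have [JM|[k kE]] := cov _ _ _ pl; first by apply: span_mod_sub; split.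
  have jn : (j < n)%N.
    by have := mem_iota 0 n j; rewrite -(perm_mem pl) mem_cat mem_head orbT.
  apply: (span_mod_eq (i := inr (k, Ordinal jn))); split.
    by apply: GB => //; apply: GP_monM => //; apply: perm_genM.
  (* The letters of [l1], j and [l2] partition those below n, so the set of [l1] and j determine
     both blocks up to order. *)
  have := perm_uniq pl; rewrite iota_uniq cat_uniq /= => /and4P[u1].
  rewrite negb_or => /andP[jl1 dis] jl2 u2.
  have mem_l i : (i < n)%N = [|| i \in l1, i == j | i \in l2].
    by have := mem_iota 0 n i; rewrite -(perm_mem pl) mem_cat inE.
  have p1 : perm_eq l1 [seq i <- iota 0 n | (i != j) && t k i].
    apply: uniq_perm => //; first by rewrite filter_uniq ?iota_uniq.
    move=> i; rewrite mem_filter mem_iota add0n /=.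
    have [->|ij] := eqVneq i j; first by rewrite (negPf jl1).
    have [i_n|] := boolP (i < n)%N; first by rewrite kE // andbT.
    by rewrite mem_l andbF => /norP[/negPf].
  have p2 : perm_eq l2 [seq i <- iota 0 n | (i != j) && ~~ t k i].
    apply: uniq_perm => //; first by rewrite filter_uniq ?iota_uniq.
    move=> i; rewrite mem_filter mem_iota add0n /=.
    have [->|ij] := eqVneq i j; first by rewrite (negPf jl2).
    have [i_n|] := boolP (i < n)%N; last first.
      by rewrite mem_l andbF => /norP[_ /norP[_ /negPf]].
    rewrite kE // andbT; move: i_n; rewrite mem_l (negPf ij) /=.
    have [i1 _|_ /= ->//] := boolP (i \in l1).
    by apply/negbTE; apply: contraNN dis => i2; apply/hasP; exists i.
  apply/IJ/gidDP => a; rewrite !evD_monM.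
  by rewrite (perm_big _ p1) (perm_big _ p2).
move=> [m [c [b [Gb ->]]]]; apply: subspace_sum => // i.
have [u pu <-] := Gb i; rewrite (mkwordK u).
set s := (_ :: _); set d := u.2.
have pus : perm_eq (unzip2 s) (iota 0 n) by [].
have [//|c1 [c2 [e eE]]] := @word_expand F s d _.
set E := c1 *: _ + _ in eE; rewrite -(subrK E (word_val _ _)).
have dec k : (k < size s)%N ->
    take k (unzip2 s) ++ nth 0%N (unzip2 s) k :: drop k.+1 (unzip2 s) =
    unzip2 s.
  by move=> ks; rewrite -drop_nth ?cat_take_drop // size_map.
rewrite -[_ - E]scale1r; apply: sS.2.
  apply: span_mod_sub; split; last exact: IJ.
  apply: GB; first exact: GP_mkword.
  apply: sG.2; first exact: GP_monR.
  apply: sG.2; first exact: GP_monS.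
  by apply: subspace_sum => // k; apply: GP_monM; rewrite ?dec.
apply: sS.2; first exact: SR.
apply: sS.2; first exact: SS.
by apply: subspace_sum => // k; apply: SM; rewrite dec.
Qed.

End Codimension.

(** * Exponential lower bound *)

Lemma exp2_gt_poly C k : exists n, (C * n.+1 ^ k < 2 ^ n)%N.
Proof.
(* Here n+1 = 4^t, so C (n+1)^k < 2^(C + 2tk), while C + 2tk < (t+1)^2 <= 4^t by the choice of t. *)
pose t := (2 * k + C)%N; exists (2 ^ (2 * t)).-1; rewrite prednK ?expn_gt0 //.
have C_lt : (C < 2 ^ C)%N by apply: ltn_expl.
have t_lt : (t < 2 ^ t)%N by apply: ltn_expl.
rewrite -expnM.
apply: (@leq_trans (2 ^ (C + 2 * t * k))%N).
  by rewrite expnD ltn_mul2r expn_gt0.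
rewrite leq_exp2l // mulnC expnM -ltnS prednK ?expn_gt0 //.
have : (t.+1 ^ 2 <= (2 ^ t) ^ 2)%N by rewrite leq_exp2r.
rewrite -expnM mulnC expnM; apply: leq_trans.
rewrite /t; nia.
Qed.

Section LowerBound.
Variable F : fieldType.
Local Open Scope classical_set_scope.
Local Notation gidD := (@gid F (UT2D F)).
Local Notation evD a := (@weval F (UT2D F) a).

Definition set_pred n (A : {set 'I_n}) : pred nat :=
  fun i => [exists x in A, val x == i].

Lemma set_predE n (A : {set 'I_n}) (x : 'I_n) : set_pred A x = (x \in A).
Proof.
apply/existsP/idP => [[y /andP[yA /eqP /val_inj <- //]]|xA].
by exists x; rewrite xA eqxx.
Qed.

(** A dual family of substitutions: letters in B become e11, other letters below n become e22, and
    the switching letter n becomes e12 + e22. The corner is nonzero only if A = B. *)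
Lemma evD_genM n (A B : {set 'I_n}) :
  evD (fun i => ut (set_pred B i)%:R (i == n)%:R (~~ set_pred B i)%:R)
    (genM F n.+1 (@set_pred n) A n) = ut 0 (A == B)%:R 0.
Proof.
rewrite evD_monM ut01E eqxx mulr1.
under eq_bigr => i _ do rewrite ut00E.
under [X in _ * X]eq_bigr => i _ do rewrite ut11E.
rewrite !big_filter; congr (ut 0 _ 0).
have [->|AB] := eqVneq A B.
  by rewrite big1 ?mul1r ?big1 // => i /andP[_ ->].
have [x xAB] : exists x, (x \in A) != (x \in B).
  apply/existsP; apply: contra_neqT AB; rewrite negb_exists => /forallP AB.
  by apply/setP => x; have := AB x; rewrite negbK => /eqP.
have xn : val x != n by rewrite neq_ltn ltn_ord.
have x_in : val x \in iota 0 n.+1.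
  by rewrite mem_iota /= add0n ltnS ltnW ?ltn_ord.
rewrite !(big_rem _ x_in) /= xn !set_predE.
by move: xAB; case: (x \in A); case: (x \in B) => //= _;
  rewrite !(mul0r, mulr0).
Qed.

Lemma gvar_UT2D_exp_growth n :
  (2 ^ n <= gcodim (gvar (UT2D F)) n.+1)%N.
Proof.
rewrite /gcodim class_gid_gvar; set P := GP _; set Q := _ `&` _.
have sI : subspace gidD.
  by rewrite -class_gid_gvar; apply: class_gid_subspace.
have sQ : subspace Q by apply: subspaceI => //; apply: lin_span_subspace.
(* Taking all subsets as index set supplies a finite generating family whose size is the
   codimension. *)
have [|[b [Pb _ genb]] _] :=
  @GP_quot F n.+1 gidD _ (@set_pred n.+1) isT sI (fun _ => id).
  move=> l1 j l2 pl; right; exists [set x | val x \in l1]%SET => i i_n ij.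
  by rewrite (set_predE _ (Ordinal i_n)) inE.
have -> : (2 ^ n)%N = #|{set 'I_n}|.
  by rewrite -cardsT -powersetT card_powerset cardsT card_ord.
pose g (i : 'I_#|{set 'I_n}|) := genM F n.+1 (@set_pred n) (enum_val i) n.
apply: (is_quot_dim_le (b := g) (subspace_span sQ) _ _ genb).
  by move=> i; apply: GP_monM => //; apply: perm_genM.
move=> c [_ Qc] i; have := Qc (fun k =>
  ut (set_pred (enum_val i) k)%:R (k == n)%:R (~~ set_pred (enum_val i) k)%:R).
rewrite weval_big; under eq_bigr => k _ do rewrite evD_genM.
move=> /(congr1 (fun v : UT2 F => v 0 1)); rewrite ut_sum ut0.
rewrite (bigD1 i) //= eqxx ut01E.
rewrite mulr1 big1 ?addr0 // => k ki.
by rewrite (inj_eq enum_val_inj) (negPf ki) ut01E mulr0.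
Qed.

Lemma gvar_UT2D_not_poly : ~ poly_growth (gvar (UT2D F)).
Proof.
move=> [C [k growth]]; have [n] := exp2_gt_poly C k; apply/negP.
rewrite -leqNgt; apply: leq_trans (gvar_UT2D_exp_growth n) _.
exact: growth.
Qed.

End LowerBound.

(** * Identities of proper subvarieties *)

Section Subvarieties.
Variable F : fieldType.
Local Open Scope classical_set_scope.
Local Notation gidD := (@gid F (UT2D F)).
Local Notation evD a := (@weval F (UT2D F) a).
Local Notation monR := (monR F).
Local Notation monS := (monS F).
Local Notation monM := (monM F).

Definition horner2 (T : {poly {poly F}}) (r s : F) : F := T.[r%:P].[s].

(** The outer variable stands for r and the inner one for s. The corner is linear in m since a
    product of upper triangular matrices uses exactly one corner entry in each of its corner
    terms. *)
Lemma dval_poly (alpha beta delta : nat -> F) l d :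
  exists P T Q : {poly {poly F}}, forall r m s,
  dval (fun i => ut (alpha i * r) (beta i * m) (delta i * s)) l d =
  ut (horner2 P r s) (m * horner2 T r s) (horner2 Q r s).
Proof.
elim: l => [|[w i] l [P [T [Q E]]]].
  exists (d 0 0)%:P%:P, 0, (d 1 1)%:P%:P => r m s.
  by rewrite /horner2 !hornerE ?mulr0 -dpart_ut.
exists ((w 0 0 * alpha i)%:P%:P * 'X * P),
  ((w 0 0 * alpha i)%:P%:P * 'X * T + (w 0 0 * beta i)%:P%:P * Q),
  ((w 1 1 * delta i)%:P%:P * 'X%:P * Q) => r m s.
rewrite /= E dpart_ut !ut_mul /horner2 !(hornerD, hornerM, hornerC, hornerX).
congr ut; ring.
Qed.

Lemma weval_poly (alpha beta delta : nat -> F) (f : freeW F) :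
  exists P T Q : {poly {poly F}}, forall r m s,
  evD (fun i => ut (alpha i * r) (beta i * m) (delta i * s)) f =
  ut (horner2 P r s) (m * horner2 T r s) (horner2 Q r s).
Proof.
rewrite /weval /lin_ext; elim: (enum_fset _) => [|u l [P [T [Q E]]]].
  exists 0, 0, 0 => r m s; rewrite big_nil /horner2 !hornerE ?mulr0.
  by rewrite ut_000.
have [P' [T' [Q' E']]] := dval_poly alpha beta delta
  ((wbasis F u.1.1.1, u.1.1.2) :: [seq (wbasis F p.1, p.2) | p <- u.1.2])
  (wbasis F u.2).
exists ((f@_u)%:P%:P * P' + P), ((f@_u)%:P%:P * T' + T),
  ((f@_u)%:P%:P * Q' + Q).
move=> r m s; rewrite big_cons E (mkwordK (map_word _ u)) word_valD // E' utZD.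
rewrite /horner2 !(hornerD, hornerM, hornerC, hornerX); congr ut; ring.
Qed.

Section Ideal.
Variable U : wclass F.
Local Notation J := (class_gid U).

Lemma class_gid_weval b f : J f -> J (weval b f).
Proof. by move=> Jf A UA a; rewrite weval_comp; apply: Jf. Qed.

Lemma class_gid_mull f g : J f -> J (wmul f g).
Proof.
move=> Jf A UA a; have -> := weval_mul a f g; rewrite (Jf A UA a).
exact: linear0_eq (@wmul_linearl F A _).
Qed.

Lemma class_gid_mulr f g : J g -> J (wmul f g).
Proof.
move=> Jg A UA a; have -> := weval_mul a f g; rewrite (Jg A UA a).
exact: linear0_eq (@wmul_linearr F A _).
Qed.

Lemma class_gid_lact w f : J f -> J (lact w f).
Proof.
move=> Jf A UA a; rewrite weval_lact (Jf A UA a).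
exact: linear0_eq (@lact_linearr F A _).
Qed.

Lemma class_gid_ract w f : J f -> J (ract f w).
Proof.
move=> Jf A UA a; rewrite weval_ract (Jf A UA a).
exact: linear0_eq (@ract_linearl F A _).
Qed.

Hypothesis UD : forall A, U A -> gvar (UT2D F) A.

Lemma gid_sub_class_gid : gidD `<=` J.
Proof. by move=> f If A /UD; apply. Qed.

(** Membership in J can be checked on values in [UT2D], because J contains all its identities. *)
Lemma class_gid_eq f g : J g ->
  (forall a : nat -> UT2 F, evD a f = evD a g) -> J f.
Proof.
move=> Jg /gidDP/gid_sub_class_gid Jfg; rewrite -(subrK g f) -[f - g]scale1r.
exact: (class_gid_subspace U).2.
Qed.

(* Evaluating f at alpha r + beta m + delta s with r, m, s generic elements of *)
(* the three Peirce components keeps it nonzero at r = e11, m = e12, s = e22.  *)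
Lemma exists_poly_identity f : J f -> ~ gidD f ->
  exists2 T : {poly {poly F}}, T != 0 & exists2 h, J h &
    forall a : nat -> UT2 F,
      evD a h = ut 0 (a 1 0 1 * horner2 T (a 0 0 0) (a 2 1 1)) 0.
Proof.
move=> Jf nIf; have [a0 a0f] : exists a0 : nat -> UT2 F, evD a0 f <> 0.
  apply: contrapT => no; apply: nIf => a; apply: contrapT => af.
  by apply: no; exists a.
(* Setting r = m = s = 1 recovers the point [a0] where f is nonzero, so one of P, T, Q is nonzero at
   (1, 1). *)
pose alpha i := a0 i 0 0; pose beta i := a0 i 0 1; pose delta i := a0 i 1 1.
pose b i : freeW F := alpha i *: monR [:: 0%N] +
  (beta i *: monM [::] 1 [::] + delta i *: monS [:: 2]).
have bE (a : nat -> UT2 F) i :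
    evD a (b i) = ut (alpha i * a 0 0 0) (beta i * a 1 0 1) (delta i * a 2 1 1).
  rewrite weval_linear -[delta i *: _]addr0 !weval_linear.
  rewrite (linear0_eq (@weval_linear _ (UT2D F) a)).
  rewrite evD_monR // evD_monM evD_monS // !big_seq1 !big_nil.
  by rewrite -(ut_000 F) !utZD; congr ut; ring.
have [P [T [Q E]]] := weval_poly alpha beta delta f.
set g := weval b f; have Jg : J g by apply: class_gid_weval.
have gE (a : nat -> UT2 F) : evD a g = ut (horner2 P (a 0 0 0) (a 2 1 1))
    (a 1 0 1 * horner2 T (a 0 0 0) (a 2 1 1)) (horner2 Q (a 0 0 0) (a 2 1 1)).
  rewrite /g weval_comp -E; congr (evD _ f); apply/funext => i; exact: bE.
have nz (R : {poly {poly F}}) : horner2 R 1 1 != 0 -> R != 0.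
  by apply: contraNneq => ->; rewrite /horner2 !hornerE.
(* If T is nonzero, e11 and e22 cut out the corner. Otherwise multiplying by e11 x_1 e22 on the
   right moves P into the corner, and on the left moves Q there. *)
have [T0|T1] := eqVneq (horner2 T 1 1) 0; last first.
  exists T; first exact: nz.
  exists (lact (e11 F) (ract g (e22 F))).
    exact/class_gid_lact/class_gid_ract.
  move=> a; rewrite weval_lact weval_ract gE.
  have [E00 E01 E11] := e11E F; have [D00 D01 D11] := e22E F.
  set v := ut _ _ _.
  have [l0 l01 l1] := lactDE (e11 F) (ract (v : UT2D F) (e22 F)).
  have [r0 r01 r1] := ractDE (e22 F) v.
  apply: ut_eq; rewrite ?ut00E ?ut01E ?ut11E.
  - by rewrite l0 r0 D00 !mulr0.
  - by rewrite l01 r01 E00 D11 mulr1 mul1r ut01E.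
  - by rewrite l1 E11 mul0r.
have evM (a : nat -> UT2 F) : evD a (monM [::] 1 [::]) = ut 0 (a 1 0 1) 0.
  by rewrite evD_monM !big_nil mul1r mulr1.
have [P0|P1] := eqVneq (horner2 P 1 1) 0; last first.
  exists P; first exact: nz.
  exists (wmul g (monM [::] 1 [::])); first exact: class_gid_mull.
  move=> a; have -> := weval_mul (A := UT2D F) a g (monM [::] 1 [::]).
  by rewrite gE evM [wmul _ _]ut_mul; congr ut; ring.
have [Q0|Q1] := eqVneq (horner2 Q 1 1) 0; last first.
  exists Q; first exact: nz.
  exists (wmul (monM [::] 1 [::]) g); first exact: class_gid_mulr.
  move=> a; have -> := weval_mul (A := UT2D F) a (monM [::] 1 [::]) g.
  by rewrite gE evM [wmul _ _]ut_mul; congr ut; ring.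
case: a0f; have <- : (fun i => ut (alpha i * 1) (beta i * 1) (delta i * 1)) = a0.
  apply/funext => i; rewrite !mulr1.
  by apply: ut_eq; rewrite ?(ut00E, ut01E, ut11E).
by rewrite E P0 T0 Q0 mulr0 ut_000.
Qed.

Hypothesis charF0 : [pchar F] =i pred0.

Lemma exists_monM_identity f : J f -> ~ gidD f ->
  exists n m, J (monM (iota 0 n) n (iota n.+1 m)).
Proof.
move=> Jf nIf; have [T T0 [h Jh hE]] := exists_poly_identity Jf nIf.
pose L := lead_coef T; have L0 : L != 0 by rewrite lead_coef_eq0.
have c0 : lead_coef L != 0 by rewrite lead_coef_eq0.
exists (size T).-1, (size L).-1; set n := (size T).-1; set m := (size L).-1.
have sT : size T = n.+1 by rewrite prednK // size_poly_gt0.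
have sL : size L = m.+1 by rewrite prednK // size_poly_gt0.
(* For p = (A, B), r becomes the sum of the letters of A and s that of the letters of B, shifted
   past the switching letter n. *)
pose b (p : {set 'I_n} * {set 'I_m}) (i : nat) : freeW F :=
  if i is i'.+1 then
    if i' is 0 then monM [::] n [::]
    else \sum_(x < m) (x \in p.2)%:R *: monS [:: (n.+1 + x)%N]
  else \sum_(x < n) (x \in p.1)%:R *: monR [:: val x].
have b0 p (a : nat -> UT2 F) :
    (evD a (b p 0%N) : UT2 F) 0 0 = \sum_(x in p.1) a x 0 0.
  rewrite weval_big ut_sum [RHS]big_mkcond; apply: eq_bigr => x _ /=.
  by rewrite evD_monR // ut00E big_seq1 mulr_natl mulrb.
have b1 p (a : nat -> UT2 F) : (evD a (b p 1%N) : UT2 F) 0 1 = a n 0 1.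
  by rewrite evD_monM ut01E !big_nil mul1r mulr1.
have b2 p (a : nat -> UT2 F) :
    (evD a (b p 2%N) : UT2 F) 1 1 = \sum_(x in p.2) a (n.+1 + x)%N 1 1.
  rewrite weval_big ut_sum [RHS]big_mkcond; apply: eq_bigr => x _ /=.
  by rewrite evD_monS // ut11E big_seq1 mulr_natl mulrb.
pose sg (p : {set 'I_n} * {set 'I_m}) : F := (-1) ^+ #|p.1| * (-1) ^+ #|p.2|.
pose k := (-1) ^+ n * n`!%:R * ((-1) ^+ m * m`!%:R) * lead_coef L.
(* Characteristic zero enters here, to make n! and m! invertible. *)
have k0 : k != 0.
  have nat0 := (pcharf0P F).1 charF0.
  by rewrite !mulf_neq0 ?signr_eq0 ?nat0 -?lt0n ?fact_gt0.
pose h' := k^-1 *: (\sum_p sg p *: weval (b p) h) + 0.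
apply: (class_gid_eq (g := h')).
  have [J0 Jl] := class_gid_subspace U; apply: Jl => //.
  apply: subspace_sum => [|p]; first exact: class_gid_subspace.
  exact: class_gid_weval.
move=> a; rewrite weval_linear weval_big (linear0_eq (@weval_linear _ (UT2D F) a)).
rewrite addr0 evD_monM.
have E p : evD a (weval (b p) h) = ut 0 (a n 0 1 *
    T.[(\sum_(x in p.1) a x 0 0)%:P].[ \sum_(x in p.2) a (n.+1 + x)%N 1 1]) 0.
  by rewrite weval_comp hE b0 b1 b2.
have -> : \sum_p sg p *: evD a (weval (b p) h) =
    ut 0 (a n 0 1 * (k * (\prod_(x < n) a x 0 0 *
                          \prod_(x < m) a (n.+1 + x)%N 1 1))) 0.
  under eq_bigr => p _ do rewrite E.
  apply: ut_eq; rewrite ut_sum ?(ut00E, ut01E, ut11E).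
  - by rewrite big1 // => p _; rewrite ut00E mulr0.
  - rewrite -(sum_sign_horner2 _ _ sT sL) pair_big mulr_sumr.
    by apply: eq_bigr => p _; rewrite ut01E mulrCA.
  - by rewrite big1 // => p _; rewrite ut11E mulr0.
have -> : \prod_(i <- iota 0 n) a i 0 0 = \prod_(x < n) a x 0 0.
  by rewrite -[n in iota _ n]subn0 big_mkord.
have -> : \prod_(i <- iota n.+1 m) a i 1 1 = \prod_(x < m) a (n.+1 + x)%N 1 1.
  rewrite -[n.+1]addn0 iotaDl big_map -[m in iota _ m]subn0 big_mkord.
  by apply: eq_bigr => x _; rewrite addn0.
rewrite -[RHS]addr0.
rewrite -(ut_000 F) utZD !mulr0 !addr0; congr (ut 0 _ 0).
by rewrite [a n 0 1 * (k * _)]mulrCA mulKf // mulrCA mulrA.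
Qed.

(** Substitute for the switching letter a [monM] that absorbs all surplus letters of [l1] and
    [l2]. *)
Lemma monM_identity n m l1 j l2 : J (monM (iota 0 n) n (iota n.+1 m)) ->
  (n <= size l1)%N -> (m <= size l2)%N -> J (monM l1 j l2).
Proof.
move=> Jnm n_le m_le.
pose b i : freeW F := if (i < n)%N then monR [:: nth 0%N l1 i]
  else if i == n then monM (drop n l1) j (drop m l2)
  else monS [:: nth 0%N l2 (i - n.+1)].
apply: class_gid_eq (class_gid_weval b Jnm) _ => a.
rewrite weval_comp !evD_monM; congr (ut 0 _ 0).
have -> : \prod_(i <- iota 0 n) (evD a (b i) : UT2 F) 0 0 =
    \prod_(i <- take n l1) a i 0 0.
  rewrite -(map_nth_iota0 0%N n_le) big_map !big_seq.
  apply: eq_bigr => i; rewrite mem_iota add0n => /andP[_ i_n].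
  by rewrite /b i_n evD_monR // ut00E big_seq1.
have -> : \prod_(i <- iota n.+1 m) (evD a (b i) : UT2 F) 1 1 =
    \prod_(i <- take m l2) a i 1 1.
  rewrite -(map_nth_iota0 0%N m_le) -[n.+1]addn0 iotaDl !big_map.
  apply: eq_bigr => i _; rewrite /b addSn ltnNge leqW ?leq_addr //=.
  rewrite gtn_eqF ?ltnS ?leq_addr // subSS addKn.
  by rewrite evD_monS // ut11E big_seq1.
rewrite /b ltnn eqxx evD_monM ut01E.
rewrite -[in LHS](cat_take_drop n l1) -[in LHS](cat_take_drop m l2) !big_cat /=.
ring.
Qed.

End Ideal.

(** * Polynomial upper bound *)

(** Short lists are tabulated by functions, so at most n^L sets occur; j pads the table, which is
    harmless as membership of j is not tested. *)
Lemma cover_ord n L j (l : seq nat) : (j < n)%N ->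
    (forall i, i \in l -> (i < n)%N) -> (size l <= L)%N ->
  exists k : {ffun 'I_L -> 'I_n}, forall i, i != j ->
    [exists x, val (k x) == i] = (i \in l).
Proof.
move=> jn l_n l_L.
exists [ffun x : 'I_L => insubd (Ordinal jn) (nth j l x)] => i ij.
have kE (x : 'I_L) : val (insubd (Ordinal jn) (nth j l x)) = nth j l x.
  rewrite val_insubd; case: ltnP => //= n_le.
  have [x_l|] := ltnP x (size l); last by move/(nth_default j).
  by have := l_n _ (mem_nth j x_l); rewrite ltnNge n_le.
apply/existsP/idP => [[x]|il].
  rewrite ffunE kE => /eqP xi; move: ij; rewrite -xi => xj.
  apply: mem_nth; rewrite ltnNge; apply: contra xj => l_x.
  by rewrite nth_default.
have iL : (index i l < L)%N by rewrite (leq_trans _ l_L) // index_mem.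
by exists (Ordinal iL); rewrite ffunE kE /= nth_index.
Qed.

Lemma proper_gsubvariety_poly (charF0 : [pchar F] =i pred0) (U : wclass F) :
  proper_gsubvariety U (gvar (UT2D F)) -> poly_growth U.
Proof.
move=> [[S US] UD [A DA nUA]].
have [f [Sf nAf]] : exists f, S f /\ ~ gid A f.
  apply: contrapT => no; apply: nUA; apply/US => f Sf.
  by apply: contrapT => nAf; apply: no; exists f.
have Jf : class_gid U f by move=> B /US; apply.
have [N [M JNM]] := exists_monM_identity UD charF0 Jf (fun If => nAf (DA _ If)).
pose L := maxn N M; exists 4, L.+1 => n n0.
(* The flag tells whether the tabulated short side lies before the switch ([true]) or after it,
   where the left block is the complement. *)
pose t (k : bool * {ffun 'I_L -> 'I_n}) : pred nat :=
  fun i => k.1 == [exists x, val (k.2 x) == i].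
have [|_ le] := GP_quot (t := t) n0 (class_gid_subspace U) (gid_sub_class_gid UD).
  move=> l1 j l2 pl.
  have l_n i : (i < n)%N = (i \in l1 ++ j :: l2).
    by rewrite (perm_mem pl) mem_iota add0n.
  have jn : (j < n)%N by rewrite l_n mem_cat mem_head orbT.
  have [N1|N1] := leqP N (size l1); last first.
    have [||k kE] := @cover_ord n L j l1 jn.
    - by move=> i i1; rewrite l_n mem_cat i1.
    - by rewrite (leq_trans (ltnW N1)) // leq_maxl.
    by right; exists (true, k) => i i_n ij; rewrite /t /= kE.
  have [M2|M2] := leqP M (size l2); last first.
    have [||k kE] := @cover_ord n L j l2 jn.
    - by move=> i i2; rewrite l_n mem_cat inE i2 !orbT.
    - by rewrite (leq_trans (ltnW M2)) // leq_maxr.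
    right; exists (false, k) => i; rewrite l_n => il ij; rewrite /t /= kE //.
    have := perm_uniq pl; rewrite iota_uniq cat_uniq /= => /and4P[_].
    rewrite negb_or => /andP[_ dis] _ _; move: il.
    rewrite mem_cat inE (negPf ij) /=.
    have [i1|] := boolP (i \in l1); last by move=> _ /= ->.
    move=> _; apply/eqP/esym/negbTE; apply: contraNN dis => i2.
    by apply/hasP; exists i.
  by left; apply: monM_identity JNM N1 M2.
apply: leq_trans le _; rewrite card_prod card_bool card_ffun !card_ord.
by rewrite expnSr; have : (0 < n ^ L * n)%N; [rewrite muln_gt0 expn_gt0 n0 | lia].
Qed.

End Subvarieties.

Theorem theorem5p7 (F : fieldType) (charF0 : [pchar F] =i pred0) :
  almost_poly_growth (gvar (UT2D F)).
Proof.
by split; [apply: gvar_UT2D_not_poly | move=> U; apply: proper_gsubvariety_poly].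
Qed.
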